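(* Let $1\le p<\infty$, $0<q<\infty$, let $\{v_n\}_{n\in\mathbb Z},\{w_n\}_{n\in\mathbb Z}$ be sequences of nonnegative real numbers and let $U$ be a regular kernel on $\mathbb Z\times\mathbb Z$. Then the following three conditions are equivalent. (i) There exists a constant $C$ such that $$\Big(\sum_{n\in\mathbb Z}w_n\Big[\sup_{-\infty<i\le n}U(i,n)\sum_{j=-\infty}^ia_j\Big]^q\Big)^{1/q}\le C\Big(\sum_{n\in\mathbb Z}a_n^pv_n\Big)^{1/p}$$ for every sequence $\{a_n\}_{n\in\mathbb Z}$ of nonnegative real numbers. (ii) There exists a constant $C'$ such that $$\Big(\sum_{n\in\mathbb Z}w_n\Big[\sum_{i=-\infty}^nU(i,n)^pa_i^p\Big]^{q/p}\Big)^{1/q}\le C'\Big(\sum_{n\in\mathbb Z}\sigma_p(-\infty,n)^{-p}a_n^p\Big)^{1/p}$$ for every sequence $\{a_n\}_{n\in\mathbb Z}$ of nonnegative real numbers. (iii) There exists a constant $C''$ such that $$\Big(\sum_{n\in\mathbb Z}w_n\Big[\sup_{-\infty<i\le n}U(i,n)^p\sum_{j=-\infty}^ia_j^p\Big]^{q/p}\Big)^{1/q}\le C''\Big(\sum_{n\in\mathbb Z}\sigma_p(-\infty,n)^{-p}a_n^p\Big)^{1/p}$$ for every sequence $\{a_n\}_{n\in\mathbb Z}$ of nonnegative real numbers. Moreover, if $C,C',C''$ are the best constants in these inequalities, then $C\approx C'\approx C''$.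
   Context: A function $U\colon\mathbb Z\times\mathbb Z\to[0,\infty)$ is a regular kernel if it is nonincreasing in the first variable, nondecreasing in the second variable, and there is a positive constant $c$ (the constant of regularity) with $U(i,n)\le c(U(i,j)+U(j,n))$ for all integers $i\le j\le n$. For $M\in\mathbb Z$, $\sigma_p(-\infty,M)=\big(\sum_{i=-\infty}^Mv_i^{1-p'}\big)^{1/p'}$ if $1<p<\infty$, where $p'=\frac p{p-1}$, and $\sigma_1(-\infty,M)=\sup_{-\infty<i\le M}v_i^{-1}$. $A\approx B$ means $c_1A\le B\le c_2A$ with positive constants $c_1,c_2$ depending only on $p$, $q$ and the constant of regularity of $U$. Sums and suprema take values in $[0,\infty]$; $0\cdot\infty=0$, $0^{-s}=\infty$, $\infty^{-s}=0$ for $s>0$. *)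

(* Defs.v *)
From HB Require Import structures.
From mathcomp Require Import all_boot all_order all_algebra.
From mathcomp Require Import all_classical all_reals all_analysis.

Set Implicit Arguments.
Unset Strict Implicit.
Unset Printing Implicit Defensive.

Import Order.TTheory GRing.Theory Num.Theory.
Local Open Scope classical_set_scope.
Local Open Scope ring_scope.

Definition nonneg_seq (R : realType) (a : int -> R) : Prop :=
  forall n, 0 <= a n.

Definition regular_with (R : realType) (U : int -> int -> R) (c : R) : Prop :=
  [/\ forall i n, 0 <= U i n,
      forall i j n, i <= j -> U j n <= U i n,
      forall i m n, m <= n -> U i m <= U i n
    & forall i j n, i <= j -> j <= n -> U i n <= c * (U i j + U j n)].

Definition regular_kernel (R : realType) (U : int -> int -> R) : Prop :=
  exists2 c : R, 0 < c & regular_with U c.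

Section Hardy.
Context {R : realType}.
Implicit Types (p q r C : R) (a v w : int -> R) (U : int -> int -> R).
Local Open Scope ereal_scope.

(* The library's real power gives 0 for 0 to a negative exponent, and its
   extended version gives +oo for +oo to a negative exponent.  Going through
   the inverse on \bar R yields 0 `^ -s = +oo and +oo `^ -s = 0 for s > 0. *)
Definition epow (x : \bar R) r : \bar R :=
  if (r < 0)%R then (x `^ (- r))^-1 else x `^ r.

Definition upto (M : int) : set int := [set i | (i <= M)%R].

Definition sigma v p (M : int) : \bar R :=
  if p == 1%R then ereal_sup [set epow (v i)%:E (-1) | i in upto M]
  else let p' := (p / (p - 1))%R in
       epow (esum (upto M) (fun i => epow (v i)%:E (1 - p')%R)) p'^-1%R.

Definition weighted_norm w (f : int -> \bar R) r s : \bar R :=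
  epow (esum [set: int] (fun n => (w n)%:E * epow (f n) r)) s^-1%R.

Definition ineq_i p q v w U C : Prop :=
  forall a, nonneg_seq a ->
  weighted_norm w
    (fun n => ereal_sup
       [set (U i n)%:E * esum (upto i) (fun j => (a j)%:E) | i in upto n])
    q q
  <= C%:E * epow (esum [set: int] (fun n => epow (a n)%:E p * (v n)%:E)) p^-1%R.

Definition sigma_norm p v a : \bar R :=
  epow (esum [set: int]
          (fun n => epow (sigma v p n) (- p)%R * epow (a n)%:E p)) p^-1%R.

Definition ineq_ii p q v w U C : Prop :=
  forall a, nonneg_seq a ->
  weighted_norm w
    (fun n => esum (upto n) (fun i => epow (U i n)%:E p * epow (a i)%:E p))
    (q / p)%R q
  <= C%:E * sigma_norm p v a.

Definition ineq_iii p q v w U C : Prop :=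
  forall a, nonneg_seq a ->
  weighted_norm w
    (fun n => ereal_sup
       [set epow (U i n)%:E p * esum (upto i) (fun j => epow (a j)%:E p)
       | i in upto n])
    (q / p)%R q
  <= C%:E * sigma_norm p v a.

(* Equal to +oo when the inequality holds with no finite constant.  The
   restriction to C >= 0 matters only when the right-hand side vanishes for
   every sequence: otherwise negative C would be admitted. *)
Definition best_constant (I : R -> Prop) : \bar R :=
  ereal_inf [set C%:E | C in [set C | (0 <= C)%R /\ I C]].

End Hardy.

(* Main.v *)
Require Import Defs.
From HB Require Import structures.
From mathcomp Require Import all_boot all_order all_algebra.
From mathcomp Require Import all_classical all_reals all_analysis.
From mathcomp Require Import zify ring lra.

Set Implicit Arguments.
Unset Strict Implicit.
Unset Printing Implicit Defensive.

Import Order.TTheory GRing.Theory Num.Theory.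
Local Open Scope classical_set_scope.
Local Open Scope ring_scope.

(** The statement is proved through the implications (ii) => (iii) => (i) =>
    (iii) => (ii), each with an explicit factor on the constant depending only on
    [p], [q] and the constant of regularity.  Below [s n] denotes
    [sigma_p(-oo, n)^(-p)], a finite nonnegative number.

    (ii) => (iii) holds with the same constant as [U] decreases in its first
    variable.

    (iii) and (i) are equivalent for every nonnegative kernel, because [s n] is the
    infimum of the costs [\sum a_j^p v_j] of the sequences on [j <= n] with sum 1.  From
    (iii) to (i), let [A_n] be the partial sums of [a] and choose [b] with
    [b_n^p = A_n^p - A_{n-1}^p]; both left-hand sides are then equal, and
    [\sum s_n b_n^p <= K \sum a_n^p v_n] is a form of Hardy's inequality
    ([hardy_telescope]), proved by telescoping a pointwise estimate
    ([sigma_weight_step]).  From (i) to (iii), superpose in [l^p] almost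
    optimal unit masses on [j <= k] with coefficients [b_k]; the costs add up and
    Minkowski's inequality bounds the partial sums from below
    ([ineq_i_iii]).

    (iii) => (ii) is where regularity enters.  After replacing [a^p] by [c], [U^p]
    by [U] and [q / p] by [r], one has to bound
    [\sum_n w_n (\sum_(i <= n) U(i,n) c_i)^r] by the same expression with
    [sup_(i <= n) U(i,n) \sum_(j <= i) (c_j + d_j)] inside, for a sequence [d]
    with [\sum s d <= \sum s c].  Cut the integers into blocks on which the tail
    [\sum_(m >= n) w_m] decreases at most by a large factor.  At the end [y] of a
    block [[x, y]], regularity bounds the inner sum by a multiple of the
    one at the end [x - 1] of the previous block, plus
    [U(x - 1, y) \sum_(i < x) c_i], plus the sum over the block itself.  The first
    is absorbed by the geometric decay of the tails, the second is one of the
    rectangles in the supremum, and the third is at most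
    [U(i, y) (\sum_(block) s c) / s_i] for the best [i] in the block, which is a
    rectangle for [d] if [d] consists of such point masses
    ([block_discretization]).

    Everything is proved for sequences of finite support and extended by monotone
    convergence ([weighted_norm_sup_le]). *)

(** * Inequalities for real powers *)

Lemma powR_add_le (R : realType) (r x y : R) : 0 < r -> 0 <= x -> 0 <= y ->
  (x + y) `^ r <= 2 `^ r * (x `^ r + y `^ r).
Proof.
move=> r0; wlog xy : x y / x <= y => [hw x0 y0|x0 y0].
  case: (leP x y) => [xy|/ltW yx]; first exact: hw.
  by rewrite addrC [x `^ r + _]addrC hw.
have r0' := ltW r0.
apply: (@le_trans _ _ ((2 * y) `^ r)).
  by rewrite ge0_ler_powR// ?nnegrE; lra.
by rewrite powRM// ler_wpM2l ?powR_ge0// lerDr powR_ge0.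
Qed.

(** The tangent line of [x `^ p] at [m]; it is Young's inequality for the
    exponents [p] and [p / (p - 1)]. *)
Lemma powR_tangent (R : realType) (p x m : R) : 1 <= p -> 0 <= x -> 0 <= m ->
  p * (x * m `^ (p - 1)) <= x `^ p + (p - 1) * m `^ p.
Proof.
move=> p1 x0 m0; have p0 : 0 < p by lra.
move: p1; rewrite le_eqVlt => /predU1P[<-|p1].
  by rewrite subrr powRr0 mulr1 mul0r addr0 powRr1// mul1r.
have q0 : 0 < p / (p - 1) by rewrite divr_gt0//; lra.
have := @conjugate_powR _ x (m `^ (p - 1)) p (p / (p - 1)) x0 (powR_ge0 _ _) p0 q0.
rewrite -powRrM [(p - 1) * _]mulrC divfK; last by rewrite gt_eqF//; lra.
rewrite invf_div => H.
have : x * m `^ (p - 1) <= x `^ p / p + m `^ p * ((p - 1) / p).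
  by apply: H; field; rewrite gt_eqF.
rewrite -(ler_pM2l p0) => /le_trans; apply.
by rewrite le_eqVlt; apply/orP; left; apply/eqP; field; rewrite gt_eqF.
Qed.

(** Jensen's inequality, from the tangent line at the weighted mean [m]. *)
Lemma hoelder_weights (R : realType) (p : R) (I : eqType) (r : seq I)
    (b x : I -> R) :
  1 <= p -> (forall k, 0 <= b k) -> (forall k, 0 <= x k) ->
  (\sum_(k <- r) b k * x k) `^ p <=
    (\sum_(k <- r) b k) `^ (p - 1) * \sum_(k <- r) b k * x k `^ p.
Proof.
move=> p1 b0 x0; have p0 : 0 < p by lra.
set B := \sum_(k <- r) b k; set S := \sum_(k <- r) b k * x k.
have B0 : 0 <= B by apply: sumr_ge0.
have S0 : 0 <= S by apply: sumr_ge0 => k _; rewrite mulr_ge0.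
move: B0; rewrite le_eqVlt => /predU1P[B0|B0].
  have /allP bz : all (fun k => true ==> (b k == 0)) r.
    by rewrite -psumr_eq0// -/B -B0.
  rewrite /S big_seq big1 => [|k /bz /= /eqP ->]; last by rewrite mul0r.
  rewrite powR0 ?gt_eqF// mulr_ge0 ?powR_ge0// sumr_ge0// => k _.
  by rewrite mulr_ge0 ?powR_ge0.
pose m := S / B; have m0 : 0 <= m by rewrite divr_ge0// ltW.
have SBm : S = B * m by rewrite /m mulrCA divff ?mulr1// gt_eqF.
have : \sum_(k <- r) b k * (p * (x k * m `^ (p - 1))) <=
    \sum_(k <- r) b k * (x k `^ p + (p - 1) * m `^ p).
  by rewrite ler_sum// => k _; rewrite ler_wpM2l// powR_tangent.
have -> : \sum_(k <- r) b k * (p * (x k * m `^ (p - 1))) = p * (B * m `^ p).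
  rewrite -(mulr_powRB1 m0 p0) [B * _]mulrA -SBm mulr_suml mulr_sumr.
  by apply: eq_bigr => k _; ring.
have -> : \sum_(k <- r) b k * (x k `^ p + (p - 1) * m `^ p) =
    \sum_(k <- r) b k * x k `^ p + (p - 1) * (B * m `^ p).
  by rewrite /B mulr_suml mulr_sumr -big_split; apply: eq_bigr => k _ /=; ring.
move=> h; rewrite SBm powRM//; last exact: ltW.
rewrite -(mulr_powRB1 (ltW B0) p0) mulrAC mulrC ler_wpM2l ?powR_ge0//.
lra.
Qed.

(** The norm of the sum of the vectors [x ^~ j] in [l^p(b)] is at most the sum of
    their norms, and each coordinate of the sum vector is at least 1.  This is
    what makes an [l^p] superposition of unit masses large. *)
Lemma minkowski_sum_ge (R : realType) (p : R) (I J : eqType) (r : seq I)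
    (s : seq J) (b : I -> R) (x : I -> J -> R) :
  1 <= p -> (forall k, 0 <= b k) -> (forall k j, 0 <= x k j) ->
  (forall k, k \in r -> 1 <= \sum_(j <- s) x k j) ->
  (\sum_(k <- r) b k) `^ p^-1 <=
    \sum_(j <- s) (\sum_(k <- r) b k * x k j `^ p) `^ p^-1.
Proof.
move=> p1 b0 x0 hx; have p0 : 0 < p by lra.
set B := \sum_(k <- r) b k.
have B0 : 0 <= B by apply: sumr_ge0.
set S := leRHS; have S0 : 0 <= S by apply: sumr_ge0 => j _; rewrite powR_ge0.
move: B0; rewrite le_eqVlt => /predU1P[<-|B0].
  by rewrite powR0// gt_eqF// invr_gt0.
have BS : B <= B `^ (1 - p^-1) * S.
  apply: (@le_trans _ _ (\sum_(j <- s) \sum_(k <- r) b k * x k j)).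
    rewrite exchange_big/= /B [leLHS]big_seq [leRHS]big_seq ler_sum// => k kr.
    by rewrite -mulr_sumr ler_peMr// hx.
  rewrite /S mulr_sumr ler_sum// => j _.
  have := @hoelder_weights _ p _ r b (x ^~ j) p1 b0 (x0 ^~ j).
  set X := \sum_(k <- r) b k * x k j; rewrite -/B; set Y := \sum_(k <- r) _ * _ `^ p.
  have X0 : 0 <= X by apply: sumr_ge0 => k _; rewrite mulr_ge0.
  have Y0 : 0 <= Y by apply: sumr_ge0 => k _; rewrite mulr_ge0 ?powR_ge0.
  have pi0 : 0 <= p^-1 by rewrite invr_ge0 ltW.
  move=> h; have : (X `^ p) `^ p^-1 <= (B `^ (p - 1) * Y) `^ p^-1.
    by rewrite ge0_ler_powR// nnegrE ?mulr_ge0 ?powR_ge0.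
  rewrite -powRrM divff ?gt_eqF// powRr1//.
  by rewrite powRM ?powR_ge0// -powRrM mulrBl divff ?gt_eqF// mul1r.
have : 0 < B `^ (1 - p^-1) by rewrite powR_gt0.
move/ler_pM2l <-; apply: le_trans BS.
by rewrite -powRD ?subrK ?powRr1// ?ltW// gt_eqF// implybT.
Qed.

(** One step of a telescoping proof of Hardy's inequality.  The function
    [(x, V) |-> x `^ p * V `^ (1 - p)] is convex and homogeneous of degree 1, so
    by its tangent at [(x + y, V + d)] its increment from [(x, V)] is at most
    [p * y * m `^ (p - 1) - (p - 1) * d * m `^ p] with the slope
    [m = (x + y) / (V + d)].  Here [y * m `^ (p - 1)] is at most a multiple of
    [y `^ p * d `^ (1 - p)] where [m] is below [M * (y / d)], and is dominated by
    [d * m `^ p] elsewhere. *)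
Lemma hardy_step (R : realType) (p : R) : 1 < p ->
  let M := p + p / (p - 1) in
  forall V d x y : R, 0 < V -> 0 < d -> 0 <= x -> 0 <= y ->
  (1 + (p - 1)^-1) * ((V + d) `^ (1 - p) * (x + y) `^ p) <=
    M `^ p * (y `^ p * d `^ (1 - p)) +
    ((V + d) `^ (1 - p) + (p - 1)^-1 * V `^ (1 - p)) * x `^ p.
Proof.
move=> p1 M V d x y V0 d0 x0 y0; have p0 : 0 < p by lra.
have p1' : 1 <= p by lra. have pm0 : 0 < p - 1 by lra.
have M0 : 0 < M by rewrite addr_gt0// divr_gt0.
have W0 : 0 < V + d by rewrite addr_gt0.
have P0 : 0 <= x + y by rewrite addr_ge0.
pose m := (x + y) / (V + d).
have m0 : 0 <= m by rewrite divr_ge0// ltW.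
have Pm : x + y = m * (V + d) by rewrite /m divfK// gt_eqF.
have scale (z W : R) : 0 <= z -> 0 < W -> z `^ p * W `^ (1 - p) = W * (z / W) `^ p.
  move=> z0 w0; rewrite powRM ?invr_ge0 ?(ltW w0)//.
  rewrite powRD; last by apply/implyP => _; rewrite gt_eqF.
  have -> : W^-1 `^ p = W `^ (- p).
    by rewrite -powR_inv1 ?(ltW w0)// -powRrM mulN1r.
  by rewrite powRr1 ?(ltW w0)// mulrCA.
have hV := @powR_tangent _ p (x / V) m p1' (divr_ge0 x0 (ltW V0)) m0.
have hP := @powR_tangent _ p x (x + y) p1' x0 P0.
set u := m `^ (p - 1).
have mpE : m `^ p = m * u by rewrite mulr_powRB1.
(* by homogeneity every term is a multiple of u, up to the tangent bounds *)
have t1 : (V + d) `^ (1 - p) * (x + y) `^ p = (x + y) * u.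
  rewrite mulrC scale// -/m mpE mulrA [(V + d) * m]mulrC -Pm//.
have t2 : V `^ (1 - p) * x `^ p >= p * x * u - (p - 1) * V * m * u.
  rewrite [leRHS]mulrC scale//.
  have : V * (p * (x / V * u)) <= V * ((x / V) `^ p + (p - 1) * m `^ p).
    by rewrite ler_pM2l.
  have -> : V * (p * (x / V * u)) = p * x * u by field; rewrite gt_eqF.
  rewrite mulrDr mpE; lra.
have t3 : (V + d) `^ (1 - p) * ((x + y) `^ p - x `^ p) <= p * y * u.
  have -> : u = (x + y) `^ (p - 1) * (V + d) `^ (1 - p).
    rewrite /u powRM ?invr_ge0 ?(ltW W0)// -powR_inv1 ?(ltW W0)// -powRrM.
    by rewrite mulN1r opprB.
  rewrite [leRHS]mulrA [leRHS]mulrC ler_wpM2l ?powR_ge0//.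
  have -> : p * y * (x + y) `^ (p - 1) =
      p * (x + y) `^ p - p * (x * (x + y) `^ (p - 1)).
    by rewrite -(mulr_powRB1 P0 p0); ring.
  lra.
have t4 : M * y * u - d * m * u <= M `^ p * (y `^ p * d `^ (1 - p)).
  rewrite scale//; set z := y / d.
  have z0 : 0 <= z by rewrite divr_ge0// ltW.
  have -> : M * y * u - d * m * u = d * (u * (M * z - m)).
    by rewrite /z; field; rewrite gt_eqF.
  rewrite [leRHS]mulrCA ler_pM2l//.
  have u0 : 0 <= u by rewrite powR_ge0.
  have Mz0 : 0 <= M * z by rewrite mulr_ge0// ltW.
  case: (leP (M * z) m) => mz.
    apply: (@le_trans _ _ 0); last by rewrite mulr_ge0 ?powR_ge0.
    by rewrite mulr_ge0_le0// subr_le0.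
  rewrite -powRM// ?(ltW M0)// -(mulr_powRB1 Mz0 p0).
  apply: (@le_trans _ _ (u * (M * z))); first by rewrite ler_wpM2l//; lra.
  by rewrite mulrC ler_wpM2l// ge0_ler_powR ?nnegrE// ltW.
have kp : (p - 1)^-1 * (p - 1) = 1 by rewrite mulVf// gt_eqF.
have k0 : 0 < (p - 1)^-1 by rewrite invr_gt0.
have t2' : (p - 1)^-1 * (V `^ (1 - p) * x `^ p) >= (p - 1)^-1 * p * x * u - V * m * u.
  have -> : (p - 1)^-1 * p * x * u - V * m * u =
      (p - 1)^-1 * (p * x * u - (p - 1) * V * m * u).
    by rewrite mulrBr !mulrA kp mul1r.
  by rewrite ler_pM2l.
have e : (p - 1)^-1 * ((x + y) * u) - (p - 1)^-1 * p * x * u + V * m * u =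
    (p - 1)^-1 * p * y * u - d * m * u.
  have -> : V * m * u = (x + y) * u - d * m * u by rewrite Pm; ring.
  by field; rewrite gt_eqF.
rewrite mulrDl mul1r [X in _ <= _ + X]mulrDl -mulrA t1.
have MyE : M * y * u = p * y * u + (p - 1)^-1 * p * y * u by rewrite /M; ring.
by move: t2' t3 t4; rewrite MyE mulrBr t1; clear - e; lra.
Qed.

(** * Domination of the sum operator by the supremum operator *)

(** On one block the weighted [l^1] duality is attained at a single point: moving
    the whole cost [\sum s j * c j] to a maximizer of [u j / s j] does not
    decrease the sum against [u]. *)
Lemma exists_max_ratio (R : realType) (u s c : nat -> R) (x y : nat) :
  (x <= y)%N -> (forall i, 0 < s i) -> (forall i, 0 <= c i) ->
  exists2 i, (x <= i <= y)%N &
    \sum_(x <= j < y.+1) u j * c j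
      <= u i * ((\sum_(x <= j < y.+1) s j * c j) / s i).
Proof.
move=> xy s0 c0.
have [i /andP[xi iy] imax] : exists2 i, (x <= i <= y)%N &
    forall j, (x <= j <= y)%N -> u j / s j <= u i / s i.
  elim: y xy => [|y IH] xy.
    by exists x; [lia|move=> j xj; have -> : j = x by lia].
  case: (leqP x y) => [|yx]; last first.
    by exists x; [lia|move=> j xj; have -> : j = x by lia].
  move=> /IH[i xiy iM].
  case: (leP (u i / s i) (u y.+1 / s y.+1)) => h.
    exists y.+1 => [|j xj]; first lia.
    case: (eqVneq j y.+1) => [->//|jy].
    by apply: le_trans h; apply: iM; lia.
  exists i => [|j xj]; first lia.
  case: (eqVneq j y.+1) => [->|jy]; first exact: ltW.
  by apply: iM; lia.
exists i; first by rewrite xi iy.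
rewrite mulrA mulrAC mulr_sumr [leLHS]big_nat [leRHS]big_nat.
rewrite ler_sum// => j xj.
have -> : u j * c j = (u j / s j) * (s j * c j).
  by rewrite mulrACA [_^-1 * _]mulrC -mulrACA divff ?mulr1// gt_eqF.
rewrite ler_wpM2r ?mulr_ge0 ?imax//; exact: ltW.
Qed.

(** The inductive step of [block_discretization] with all sums replaced by
    numbers: [tx], [ty], [t1] are the tails of the weight at the beginning of the
    block, at its last point and just after it, [ex] and [ey] the powers of the
    operator before and at the end of the block, [f] and [Fy] those of the
    majorant.  The ratio [lam] exceeds twice the constant [A] by which [ex]
    enters [ey], so that the contribution of [ey] carried past the block costs
    at most another [A * ex * tx]; the remaining multiple of [Fy] is split into
    [f] and [Fy - f], the latter being charged to [Q]. *)
Lemma block_absorption (R : realType) (A K ex ey Fy f tx ty t1 Q Q1 S1 S2 : R) :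
  let lam := 2 * A + 2 in let be := 4 * K in
  0 <= A -> 0 <= K -> 0 <= ex -> 0 <= ey -> 0 <= f -> f <= Fy ->
  0 <= t1 -> tx <= lam * ty -> lam * t1 <= tx ->
  S1 <= (tx - t1) * ey ->
  S2 <= t1 * (2 * A * ey + be * Fy) + lam * be * Q1 ->
  ey <= A * ex + K * Fy ->
  Q1 + ty * (Fy - f) <= Q ->
  S1 + S2 <= tx * (2 * A * ex + be * f) + lam * be * Q.
Proof.
move=> lam be A0 K0 ex0 ey0 f0 fF t10 txy t1x hS1 hS2 hey hQ.
have At1 : 0 <= A * t1 by rewrite mulr_ge0.
have h1 : 0 <= tx - 2 * (A * t1) - 2 * t1 by move: t1x; rewrite /lam; lra.
have h2 : 2 * (A * t1) * ey + 2 * t1 * ey <= tx * ey.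
  by rewrite -mulrDl ler_wpM2r//; lra.
have t1ey : 0 <= t1 * ey by rewrite mulr_ge0.
have h3 : tx * ey <= tx * (A * ex + K * Fy) by rewrite ler_wpM2l//; lra.
have h4 : 2 * t1 * (be * Fy) <= tx * (be * Fy).
  by rewrite ler_wpM2r ?mulr_ge0//; lra.
have h5 : be * tx * (Fy - f) <= be * (lam * ty) * (Fy - f).
  by rewrite ler_wpM2r ?subr_ge0// ler_wpM2l// mulr_ge0.
have h6 : lam * be * (Q1 + ty * (Fy - f)) <= lam * be * Q.
  by rewrite ler_wpM2l// !mulr_ge0// /lam; lra.
move: hS1 hS2 h2 h3 h4 h5 h6; rewrite /be; move: lam {be t1x h1 txy} => lam.
lra.
Qed.

(** Induction from the right over blocks on which the tail [T] of the weight
    drops by a factor at most [lam].  Quasi-additivity of [U] splits the sum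
    up to the end [y] of a block into the sum at the previous block end, the
    rectangle [U x.-1 y * \sum_(i < x) c i], and the part inside the block.
    The first is absorbed by the geometric decay of [T], the second is
    below the majorant [F], and the third is at most [U i0 y * d i0] for the
    point mass given by [exists_max_ratio].

    The masses [d] depend on the blocks, hence the quantifier order: [d] first,
    then any nondecreasing [F] above the two families of rectangles.  The
    increments [F n `^ r - F x.-1 `^ r] on the right make the successive
    contributions of the blocks add up instead of being counted twice. *)
Lemma block_discretization (R : realType) (r k : R) (L : nat)
    (U : nat -> nat -> R) (w s c : nat -> R) :
  0 < r -> 0 <= k ->
  (forall i n, 0 <= U i n) ->
  (forall i m n, (m <= n)%N -> U i m <= U i n) ->
  (forall i j n, (i <= j)%N -> (j <= n)%N -> U i n <= k * (U i j + U j n)) ->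
  (forall n, 0 <= w n) -> (forall n, 0 < s n) -> (forall n, 0 <= c n) ->
  let A := (2 `^ r * k `^ r) in let K := 2 `^ r * (k + 1) `^ r in
  let lam := 2 * A + 2 in let be := 4 * K in
  let T x := \sum_(x <= n < L) w n in
  let E x := \sum_(0 <= i < x) U i x.-1 * c i in
  forall x, (x <= L)%N ->
  exists d : nat -> R, [/\ forall n, 0 <= d n, forall n, (n < x)%N -> d n = 0,
    \sum_(x <= i < L) s i * d i <= \sum_(x <= i < L) s i * c i &
    forall F : nat -> R, (forall n, 0 <= F n) ->
      (forall m n, (m <= n)%N -> F m <= F n) ->
      (forall i n, (i <= n)%N -> (n < L)%N ->
         U i n * (\sum_(0 <= j < i.+1) c j) <= F n) ->
      (forall i n, (i <= n)%N -> (n < L)%N -> U i n * d i <= F n) ->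
      \sum_(x <= n < L) w n * E n.+1 `^ r <=
        T x * (2 * A * E x `^ r + be * F x.-1 `^ r) +
        lam * be * \sum_(x <= n < L) w n * (F n `^ r - F x.-1 `^ r)].
Proof.
move=> r0 k0 U0 Umon Ureg w0 s0 c0 A K lam be T E x.
have A0 : 0 <= A by rewrite mulr_ge0 ?powR_ge0.
have K0 : 0 <= K by rewrite mulr_ge0 ?powR_ge0.
have E0 n : 0 <= E n by apply: sumr_ge0 => i _; rewrite mulr_ge0.
have lam2 : 2 <= lam by rewrite /lam; lra.
have T0 n : 0 <= T n by apply: sumr_ge0.
have [N] := ubnP (L - x)%N; elim: N x => // N IH x LxN xL.
have TL : T L = 0 by rewrite /T big_geq.
case: (ltnP x L) => [xltL|Lx]; last first.
  have -> : x = L by lia.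
  exists (fun=> 0); split => // [|F F0 Fm FC Fd]; first by rewrite !big_geq.
  by rewrite TL !big_geq// mul0r mulr0 addr0.
(* the block of x ends at the last y whose tail is comparable to that of x *)
have [y /and3P[xy yL TxTy] ymax] : exists2 y : nat,
    [&& (x <= y)%N, (y < L)%N & T x <= lam * T y] &
    forall z : nat, [&& (x <= z)%N, (z < L)%N & T x <= lam * T z] -> (z <= y)%N.
  have Px : [&& (x <= x)%N, (x < L)%N & T x <= lam * T x].
    by rewrite leqnn xltL/= ler_peMl//; lra.
  have Pub i : [&& (x <= i)%N, (i < L)%N & T x <= lam * T i] -> (i <= L)%N.
    by move=> /and3P[_ /ltnW].
  have [y Py yM] := ex_maxnP (ex_intro _ x Px) Pub.
  by exists y.
have Ty1 : lam * T y.+1 <= T x.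
  case: (leqP L y.+1) => [Ly|yL1].
    have -> : y.+1 = L by lia.
    by rewrite TL mulr0.
  rewrite leNgt; apply/negP => h.
  by have := ymax y.+1; rewrite yL1 (ltW h) (leq_trans xy) ?ltnn//= => /(_ isT).
have Tyw : T y = w y + T y.+1 by rewrite /T big_ltn.
have xy1 : (x <= y.+1)%N := leqW xy.
have [|//|d' [d'0 d'z d'S d'F]] := IH y.+1 _ _; first by lia.
have [i0 /andP[xi0 i0y] hi0] := @exists_max_ratio _ (fun i => U i y) s c x y xy s0 c0.
set S := \sum_(x <= j < y.+1) s j * c j in hi0.
have S0 : 0 <= S by apply: sumr_ge0 => j _; rewrite mulr_ge0// ltW.
(* one mass at the extremal point of the block, then the masses of the
   later blocks *)
pose d n := if n == i0 then S / s i0 else d' n.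
exists d; split.
- by move=> n; rewrite /d; case: ifP => // _; rewrite divr_ge0// ltW.
- move=> n nx; rewrite /d; case: eqP => [ni0|_]; last exact/d'z/(leq_trans nx).
  by move: nx; rewrite ni0 ltnNge xi0.
- rewrite (@big_cat_nat _ _ _ y.+1)//= [leRHS](@big_cat_nat _ _ _ y.+1)//=.
  apply: lerD; last first.
    apply: le_trans d'S; rewrite big_nat [leRHS]big_nat ler_sum// => j jy.
    rewrite /d; case: eqP => // ji; move: jy.
    by rewrite ji ltnNge i0y.
  rewrite -/S (eq_big_nat _ _ (F2 := fun i => if i == i0 then S else 0)); last first.
    move=> j jxy; rewrite /d; case: eqP => [->|_]; last first.
      by rewrite d'z ?mulr0//; case/andP: jxy.
    by rewrite mulrC -mulrA mulVf ?mulr1// gt_eqF.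
  rewrite -big_mkcond/= big_nat1_eq.
  by case: ifP.
move=> F F0 Fm FC Fd.
have {d'F} := d'F F F0 Fm FC.
have Fd' i n : (i <= n)%N -> (n < L)%N -> U i n * d' i <= F n.
  move=> iin nL; case: (eqVneq i i0) => [->|ii0].
    by rewrite d'z ?mulr0.
  by have := Fd i n iin nL; rewrite /d (negPf ii0).
move=> /(_ Fd') /= IHF.
have Ey : E y.+1 <= k * E x + (k + 1) * F y.
  rewrite /E/= (@big_cat_nat _ _ _ x)//=.
  have h1 : \sum_(0 <= i < x) U i y * c i <=
      k * (\sum_(0 <= i < x) U i x.-1 * c i) + k * F y.
    case: x {LxN xL xltL xy ymax TxTy Ty1 xy1 xi0 hi0 S S0 d Fd} (xy) => [|x] xy.
      by rewrite !big_geq// mulr0 add0r mulr_ge0.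
    apply: (@le_trans _ _
        (\sum_(0 <= i < x.+1) k * (U i x + U x y) * c i)).
      rewrite big_nat [leRHS]big_nat ler_sum// => i /andP[_ ix].
      by rewrite ler_wpM2r// Ureg// ltnW.
    under eq_bigr do rewrite -mulrA mulrDl mulrDr.
    rewrite big_split/= -!mulr_sumr lerD2l ler_wpM2l//.
    by apply: FC => //; exact: ltnW.
  have h2 : \sum_(x <= i < y.+1) U i y * c i <= F y.
    apply: le_trans hi0 _; have := Fd i0 y; rewrite /d eqxx; exact.
  by rewrite mulrDl mul1r addrA lerD.
have Eyr : E y.+1 `^ r <= A * E x `^ r + K * F y `^ r.
  apply: (@le_trans _ _ ((k * E x + (k + 1) * F y) `^ r)).
    by rewrite ge0_ler_powR ?nnegrE// ?addr_ge0 ?mulr_ge0 ?addr_ge0// ltW.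
  apply: le_trans (powR_add_le r0 _ _) _; rewrite ?mulr_ge0 ?addr_ge0//.
  by rewrite !powRM// ?addr_ge0// mulrDr !mulrA.
have r0' := ltW r0.
have Emon m n : (m <= n)%N -> E m.+1 <= E n.+1.
  move=> mn; rewrite /E/= (@big_cat_nat _ _ _ m.+1 0 n.+1)//=.
  rewrite ler_wpDr ?sumr_ge0//; first by move=> i _; rewrite mulr_ge0.
  by rewrite ler_sum// => i _; rewrite ler_wpM2r// Umon.
have L1 : \sum_(x <= n < y.+1) w n * E n.+1 `^ r <= (T x - T y.+1) * E y.+1 `^ r.
  have -> : T x - T y.+1 = \sum_(x <= n < y.+1) w n.
    by rewrite /T (@big_cat_nat _ _ _ y.+1 x)//= addrK.
  rewrite mulr_suml big_nat [leRHS]big_nat ler_sum// => n /andP[_ ny].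
  by rewrite ler_wpM2l// ge0_ler_powR ?nnegrE// Emon.
have Fr m n : (m <= n)%N -> F m `^ r <= F n `^ r.
  by move=> mn; rewrite ge0_ler_powR ?nnegrE// Fm.
set f := F x.-1 `^ r.
have L2 : \sum_(y.+1 <= n < L) w n * (F n `^ r - F y `^ r) + T y * (F y `^ r - f)
    <= \sum_(x <= n < L) w n * (F n `^ r - f).
  rewrite [leRHS](@big_cat_nat _ _ _ y)//=; last exact: ltnW.
  rewrite ler_wpDl//.
    rewrite big_nat sumr_ge0// => n /andP[xn _]; rewrite mulr_ge0// subr_ge0 Fr//.
    exact: leq_trans (leq_pred _) xn.
  rewrite [leRHS]big_ltn// Tyw mulrDl addrCA lerD2l.
  rewrite /T mulr_suml -big_split/= ler_sum// => n _.
  by rewrite -mulrDr subrKA.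
rewrite (@big_cat_nat _ _ _ y.+1)//=.
have fF : f <= F y `^ r by apply: Fr; exact: leq_trans (leq_pred _) xy.
have f0 : 0 <= f by rewrite powR_ge0.
exact: (block_absorption A0 K0 (powR_ge0 _ _) (powR_ge0 _ _) f0 fF (T0 _) TxTy Ty1
  L1 IHF Eyr L2).
Qed.

(** The converse of the trivial bound of the supremum operator by the sum
    operator: at the price of adding to [c] a sequence [d] of no larger cost, the
    sums are dominated by any [F] that dominates the rectangles of [c] and the
    atoms of [d].  All exponents [r > 0] are allowed because only the
    quasi-triangle inequality of [x `^ r] is used. *)
Lemma sum_le_sup_finite (R : realType) (r k : R) : 0 < r -> 0 <= k ->
  exists2 M : R, 0 < M & forall (L : nat)
    (U : nat -> nat -> R) (w s c : nat -> R),
  (forall i n, 0 <= U i n) ->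
  (forall i m n, (m <= n)%N -> U i m <= U i n) ->
  (forall i j n, (i <= j)%N -> (j <= n)%N -> U i n <= k * (U i j + U j n)) ->
  (forall n, 0 <= w n) -> (forall n, 0 < s n) -> (forall n, 0 <= c n) ->
  exists d : nat -> R, [/\ forall n, 0 <= d n,
    \sum_(0 <= i < L) s i * d i <= \sum_(0 <= i < L) s i * c i &
    forall F : nat -> R, (forall n, 0 <= F n) ->
      (forall m n, (m <= n)%N -> F m <= F n) ->
      (forall i n, (i <= n)%N -> (n < L)%N ->
         U i n * (\sum_(0 <= j < i.+1) c j) <= F n) ->
      (forall i n, (i <= n)%N -> (n < L)%N -> U i n * d i <= F n) ->
      \sum_(0 <= n < L) w n * (\sum_(0 <= i < n.+1) U i n * c i) `^ r <=
        M * \sum_(0 <= n < L) w n * F n `^ r].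
Proof.
move=> r0 k0.
pose A := 2 `^ r * k `^ r; pose K := 2 `^ r * (k + 1) `^ r.
have A0 : 0 <= A by rewrite mulr_ge0 ?powR_ge0.
have K0 : 0 < K by rewrite mulr_gt0// powR_gt0//; lra.
exists ((2 * A + 2) * (4 * K)).
  by rewrite mulr_gt0//; lra.
move=> L U w s c U0 Umon Ureg w0 s0 c0.
have [d [d0 _ dS dF]] :=
  block_discretization r0 k0 U0 Umon Ureg w0 s0 c0 (leq0n L).
exists d; split => // F F0 Fm FC Fd.
have := dF F F0 Fm FC Fd.
rewrite /= (@big_geq _ _ _ 0%N 0%N)// powR0 ?gt_eqF// mulr0 add0r => /le_trans; apply.
rewrite -/A -/K.
set X := \sum_(0 <= n < L) w n; set f := F 0%N `^ r.
have -> : \sum_(0 <= n < L) w n * (F n `^ r - f) =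
    \sum_(0 <= n < L) w n * F n `^ r - X * f.
  by rewrite mulr_suml -sumrB; apply: eq_bigr => n _; rewrite mulrBr.
have Xf : 0 <= X * f by rewrite mulr_ge0 ?powR_ge0// sumr_ge0.
have h : X * (4 * K * f) <= (2 * A + 2) * (4 * K) * (X * f).
  by rewrite [leLHS]mulrCA -[leRHS]mulrA ler_peMl//; [apply: mulr_ge0 => //|]; lra.
rewrite mulrBr; lra.
Qed.

(** * Extended powers, sums and weighted norms *)

Lemma epowE (R : realType) (x : \bar R) (r : R) : 0 <= r -> epow x r = (x `^ r)%E.
Proof. by move=> r0; rewrite /epow ltNge r0. Qed.

Lemma le_poweR (R : realType) (r : R) (x y : \bar R) : 0 <= r -> (0 <= x)%E ->
  (x <= y)%E -> (x `^ r <= y `^ r)%E.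
Proof.
move=> r0 x0 xy; apply: gt0_ler_poweR => //; rewrite in_itv/= leey ?x0//.
by rewrite (le_trans x0 xy).
Qed.

Lemma poweRK (R : realType) (r : R) (x : \bar R) : 0 < r -> (0 <= x)%E ->
  ((x `^ r) `^ r^-1 = x)%E.
Proof. by move=> r0 x0; rewrite -poweRrM divff ?gt_eqF// poweRe1. Qed.

Lemma poweRVK (R : realType) (r : R) (x : \bar R) : 0 < r -> (0 <= x)%E ->
  ((x `^ r^-1) `^ r = x)%E.
Proof. by move=> r0 x0; rewrite -poweRrM mulVf ?gt_eqF// poweRe1. Qed.

Lemma poweR_inv_le (R : realType) (r : R) (x y : \bar R) : 0 < r ->
  (0 <= x)%E -> (0 <= y)%E -> (x `^ r^-1 <= y)%E = (x <= y `^ r)%E.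
Proof.
move=> r0 x0 y0; apply/idP/idP => h.
  by rewrite -[leLHS](poweRVK r0 x0) le_poweR ?poweR_ge0// ltW.
by rewrite -[leRHS](poweRK r0 y0) le_poweR ?poweR_ge0// ltW// invr_gt0.
Qed.

(** The hypothesis on [h] says that it is at most the supremum of [g]. *)
Lemma lee_sup_add (R : realType) (I : Type) (g : I -> \bar R) (h y d : \bar R) :
  I -> (forall x, (forall i, g i <= x) -> h <= x)%E ->
  (forall i, 0 <= g i)%E -> (0 <= y)%E ->
  (forall i, g i + y <= d)%E -> (h + y <= d)%E.
Proof.
move=> i0 hg g0; case: y => [y| |//] y0 H; last first.
  by move: (H i0); rewrite addey ?leye_eq; [move=> /eqP ->; rewrite leey|
     rewrite gt_eqF// (lt_le_trans _ (g0 i0)) ?ltNyr].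
by rewrite -leeBrDr//; apply: hg => i; rewrite leeBrDr.
Qed.

(** Monotone convergence for finite sums: the indices at which the
    terms are approximated are merged by taking their maximum. *)
Lemma sum_sup_le (R : realType) (T : Type) (r : seq T) (h : T -> \bar R)
    (g : nat -> T -> \bar R) (d : \bar R) :
  (forall n x, (forall N, g N n <= x) -> h n <= x)%E ->
  (forall n, 0 <= h n)%E ->
  (forall N n, 0 <= g N n)%E ->
  (forall N M n, (N <= M)%N -> (g N n <= g M n)%E) ->
  (forall N, \sum_(n <- r) g N n <= d)%E -> (\sum_(n <- r) h n <= d)%E.
Proof.
move=> hg h0 g0 gm H.
suff : forall e, (0 <= e)%E -> (forall N, e + \sum_(n <- r) g N n <= d)%E ->
    (e + \sum_(n <- r) h n <= d)%E.
  by move=> /(_ 0%E (lexx _)); rewrite add0e; apply => N; rewrite add0e.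
elim: r {H} => [|n r IH] e e0 H.
  by have := H 0%N; rewrite !big_nil.
rewrite big_cons addeA; apply: IH => [|N].
  by apply: adde_ge0.
rewrite [(e + _)%E]addeC -addeA; apply: (@lee_sup_add _ nat (g ^~ n)) => //.
- exact: hg.
- by rewrite adde_ge0// sume_ge0.
move=> M; apply: le_trans (H (maxn N M)).
rewrite big_cons addeCA leeD2l//.
by apply: leeD; [apply: gm; exact: leq_maxr|apply: lee_sum => i _; apply: gm; exact: leq_maxl].
Qed.

Lemma weighted_norm_le (R : realType) (w : int -> R) (f : int -> \bar R)
    (r s : R) (B : \bar R) :
  0 < r -> 0 < s -> nonneg_seq w -> (0 <= B)%E ->
  (weighted_norm w f r s <= B)%E =
  (esum [set: int] (fun n => (w n)%:E * (f n) `^ r) <= B `^ s)%E.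
Proof.
move=> r0 s0 w0 B0; have s0' : 0 <= s^-1 by rewrite invr_ge0 ltW.
have r0' := ltW r0.
rewrite /weighted_norm (epowE _ s0') poweR_inv_le//.
  by under eq_esum do rewrite epowE//.
by apply: esum_ge0 => n _; rewrite mule_ge0 ?lee_fin// epowE ?poweR_ge0.
Qed.

Lemma le_weighted_norm (R : realType) (w : int -> R) (f g : int -> \bar R)
    (r r' s : R) :
  0 < r -> 0 < r' -> 0 < s -> nonneg_seq w ->
  (forall n, f n `^ r <= g n `^ r')%E ->
  (weighted_norm w f r s <= weighted_norm w g r' s)%E.
Proof.
move=> r0 r'0 s0 w0 fg.
have s0' : 0 <= s^-1 by rewrite invr_ge0 ltW.
have wn0 : (0 <= weighted_norm w g r' s)%E.
  by rewrite /weighted_norm (epowE _ s0') poweR_ge0.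
rewrite weighted_norm_le// /weighted_norm [X in (_ <= X `^ _)%E](epowE _ s0').
have r'0' := ltW r'0.
rewrite poweRVK//; last first.
  by apply: esum_ge0 => n _; rewrite mule_ge0 ?lee_fin// epowE ?poweR_ge0.
apply: le_esum => n _; rewrite epowE//.
by rewrite lee_wpmul2l ?lee_fin// fg.
Qed.

Lemma esum_le (R : realType) (T : choiceType) (D : set T) (f : T -> \bar R)
    (x : \bar R) :
  (forall r : seq T, uniq r -> (forall i, i \in r -> D i) ->
     (\sum_(i <- r) f i <= x)%E) ->
  (esum D f <= x)%E.
Proof.
move=> H; apply: ge_ereal_sup => _ [X [finX XD] <-].
rewrite fsbig_finite//; apply: H => // i.
by rewrite in_fset_set// inE => /XD.
Qed.

Lemma esum_gt (R : realType) (T : choiceType) (D : set T) (f : T -> \bar R)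
    (x : \bar R) : (x < esum D f)%E ->
  exists r : seq T, [/\ uniq r, forall i, i \in r -> D i &
    (x < \sum_(i <- r) f i)%E].
Proof.
move=> xD; apply: contrapT => H; move: xD; apply/negP; rewrite -leNgt.
apply: esum_le => r ur rD; rewrite leNgt; apply/negP => xr.
by apply: H; exists r.
Qed.

Lemma le_sum_esum (R : realType) (T : choiceType) (D : set T) (f : T -> \bar R)
    (r : seq T) : uniq r -> (forall i, i \in r -> D i) ->
  (\sum_(i <- r) f i <= esum D f)%E.
Proof.
move=> ur rD; rewrite fsbig_seq//; apply: esum_ge; by exists [set` r] => //; split => // i /= /rD.
Qed.

Lemma esum_supp (R : realType) (T : choiceType) (D : set T) (f : T -> \bar R)
    (r : seq T) : uniq r -> (forall i, 0 <= f i)%E ->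
  (forall i, D i -> i \notin r -> f i = 0%E) ->
  esum D f = (\sum_(i <- r | i \in D) f i)%E.
Proof.
move=> ur f0 fr; apply/eqP; rewrite eq_le; apply/andP; split.
  apply: esum_le => s us sD.
  rewrite (bigID (mem r))/= [X in (_ + X)%E](_ : _ = 0%E) ?adde0; last first.
    by rewrite big_seq_cond big1// => i /andP[/sD Di ir]; rewrite fr.
  rewrite -big_filter -[leRHS]big_filter [leLHS]fsbig_seq ?filter_uniq//
    [leRHS]fsbig_seq ?filter_uniq//.
  apply: lee_fsum_nneg_subset; rewrite ?finite_seq//.
  move=> i /set_mem/=; rewrite mem_filter => /andP[ir /sD Di].
  by rewrite inE/= mem_filter ir mem_set.
rewrite -big_filter; apply: le_sum_esum; first exact: filter_uniq.
by move=> i; rewrite mem_filter => /andP[/set_mem].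
Qed.

(** Monotone convergence for the weighted norms; it reduces the three
    inequalities to sequences of finite support. *)
Lemma weighted_norm_sup_le (R : realType) (w : int -> R) (f : int -> \bar R)
    (g : nat -> int -> \bar R) (r s : R) (B : \bar R) :
  0 < r -> 0 < s -> nonneg_seq w -> (0 <= B)%E ->
  (forall n, 0 <= f n)%E ->
  (forall n x, (forall N, g N n <= x) -> f n <= x)%E ->
  (forall N n, 0 <= g N n)%E ->
  (forall N M n, (N <= M)%N -> (g N n <= g M n)%E) ->
  (forall N, weighted_norm w (g N) r s <= B)%E ->
  (weighted_norm w f r s <= B)%E.
Proof.
move=> r0 s0 w0 B0 f0 fg g0 gm; rewrite weighted_norm_le// => H.
have r0' := ltW r0.
apply: esum_le => l ul _.
apply: (@sum_sup_le _ _ _ _ (fun N n => (w n)%:E * g N n `^ r)%E) => //.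
- move=> n x hx.
  have x0 : (0 <= x)%E by apply: le_trans (hx 0%N); rewrite mule_ge0 ?lee_fin ?poweR_ge0.
  have := w0 n; rewrite le_eqVlt => /predU1P[<-|wn]; first by rewrite mul0e.
  have xw : (0 <= (w n)^-1%:E * x)%E by rewrite mule_ge0// lee_fin invr_ge0 ltW.
  rewrite -lee_pdivlMl// -[r]invrK poweR_inv_le ?invr_gt0//.
  apply: fg => N; rewrite -poweR_inv_le ?invr_gt0// invrK lee_pdivlMl//.
- by move=> n; rewrite mule_ge0 ?lee_fin ?poweR_ge0.
- by move=> N n; rewrite mule_ge0 ?lee_fin ?poweR_ge0.
- by move=> N M n NM; rewrite lee_wpmul2l ?lee_fin// le_poweR// gm.
- move=> N; have := H N; rewrite weighted_norm_le//; apply: le_trans.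
  exact: le_sum_esum.
Qed.

Lemma esumZl (R : realType) (T : choiceType) (D : set T) (f : T -> \bar R)
    (c : R) : 0 <= c -> (forall i, 0 <= f i)%E ->
  (c%:E * esum D f)%E = esum D (fun i => c%:E * f i)%E.
Proof.
rewrite le_eqVlt => /predU1P[<-|c0] f0.
  by rewrite mul0e esum1// => i _; rewrite mul0e.
apply/eqP; rewrite eq_le; apply/andP; split.
  rewrite -lee_pdivlMl//; apply: esum_le => r ur rD.
  rewrite lee_pdivlMl// ge0_sume_distrr//.
  exact: (@le_sum_esum _ _ _ (fun i => c%:E * f i)%E).
apply: esum_le => r ur rD; rewrite -ge0_sume_distrr//.
by rewrite lee_wpmul2l ?lee_fin ?(ltW c0)// le_sum_esum.
Qed.

(** Removes the arbitrarily small error [e * z] under the root. *)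
Lemma eps_root (R : realType) (p c y z : R) (x : \bar R) :
  0 < p -> 0 <= c -> 0 <= y -> 0 <= z -> (0 <= x)%E ->
  (forall e : R, 0 < e -> (x <= (c * (y + e * z) `^ p^-1)%:E)%E) ->
  (x <= (c * y `^ p^-1)%:E)%E.
Proof.
move=> p0 c0 y0 z0; case: x => [x| |//] x0 H; last by have := H 1 ltr01.
rewrite lee_fin in x0; rewrite lee_fin.
have H' e : 0 < e -> x `^ p <= c `^ p * (y + e * z).
  move=> e0; have yz0 : 0 <= y + e * z by rewrite addr_ge0// mulr_ge0// ltW.
  have -> : c `^ p * (y + e * z) = (c * (y + e * z) `^ p^-1) `^ p.
    by rewrite powRM ?powR_ge0// -powRrM mulVf ?gt_eqF// powRr1.
  by rewrite ge0_ler_powR ?nnegrE ?mulr_ge0 ?powR_ge0 -?lee_fin ?H// ltW.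
have {H'} H : x `^ p <= c `^ p * y.
  apply/ler_addgt0Pr => e e0.
  have cz0 : 0 <= c `^ p * z by rewrite mulr_ge0 ?powR_ge0.
  have cz1 : 0 < c `^ p * z + 1 by lra.
  apply: le_trans (H' (e / (c `^ p * z + 1)) _) _; first by rewrite divr_gt0.
  rewrite mulrDr lerD2l mulrCA -mulrA ler_piMr ?(ltW e0)//.
  by rewrite ler_pdivrMl// mulr1; lra.
have -> : x = (x `^ p) `^ p^-1 by rewrite -powRrM divff ?gt_eqF// powRr1.
have -> : c * y `^ p^-1 = (c `^ p * y) `^ p^-1.
  by rewrite powRM ?powR_ge0// -powRrM divff ?gt_eqF// powRr1.
by rewrite ge0_ler_powR ?nnegrE ?mulr_ge0 ?powR_ge0// invr_ge0 ltW.
Qed.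

(** * The weight given by sigma *)

Section sigma_weight.
Variable R : realType.
Implicit Types (v a : int -> R) (p x y e : R) (n : int).

(** The weight of the right-hand sides of (ii) and (iii).  It is a finite real
    number since [v] is finite, which keeps [sigma] away from 0. *)
Definition sigma_weight v p n : R := fine (epow (sigma v p n) (- p)).

Lemma epow_inv (x : \bar R) (r : R) : 0 < r -> epow x (- r) = ((x `^ r)^-1)%E.
Proof. by move=> r0; rewrite /epow oppr_lt0 r0 opprK. Qed.

(** For [1 < p], the weight dual to [v]; [sigma] is then the power
    [(p / (p - 1))^-1] of its partial sums. *)
Let dual v p i : \bar R := epow (v i)%:E (1 - p / (p - 1)).

Lemma dual0 v p i : 1 < p -> v i = 0 -> dual v p i = +oo%E.
Proof.
move=> p1 vi; have q1 : 0 < p / (p - 1) - 1.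
  by rewrite subr_gt0 ltr_pdivlMr ?mul1r; lra.
by rewrite /dual -(opprB _ 1) epow_inv// vi poweR0r ?inve0// gt_eqF.
Qed.

Lemma dual_gt0 v p i : 1 < p -> 0 < v i ->
  dual v p i = (v i `^ (1 - p / (p - 1)))%:E.
Proof.
move=> p1 vi; have q1 : 0 < p / (p - 1) - 1.
  by rewrite subr_gt0 ltr_pdivlMr ?mul1r; lra.
rewrite /dual -(opprB _ 1) epow_inv// poweR_EFin inver gt_eqF ?powR_gt0//.
by rewrite powRN.
Qed.

Lemma dual_ge0 v p i : (0 <= dual v p i)%E.
Proof. by rewrite /dual /epow; case: ifP => _; rewrite ?inve_ge0 poweR_ge0. Qed.

Let dual_sum v p n : \bar R := esum (upto n) (dual v p).

Lemma dual_sum_gt0 v p n : 1 < p -> nonneg_seq v -> (0 < dual_sum v p n)%E.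
Proof.
move=> p1 v0; apply: (@lt_le_trans _ _ (dual v p n)).
  have := v0 n; rewrite le_eqVlt => /predU1P[/esym vn|vn].
    by rewrite dual0// ltry.
  by rewrite dual_gt0// lte_fin powR_gt0.
have := @le_sum_esum _ _ (upto n) (dual v p) [:: n] isT.
rewrite big_seq1; apply => i; rewrite inE => /eqP ->.
by rewrite /upto/=.
Qed.

Lemma dual_sum_rec v p n : dual_sum v p n = (dual_sum v p (n - 1) + dual v p n)%E.
Proof.
rewrite /dual_sum (esumID (upto (n - 1))); last by move=> i _; exact: dual_ge0.
congr (_ + _)%E.
  congr (esum _ _); apply/seteqP; split => i; rewrite /upto/=; first by case.
  by move=> h; split => //; lia.
rewrite (_ : upto n `&` ~` upto (n - 1) = [set n]).
  by rewrite esum_set1// dual_ge0.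
apply/seteqP; split => i; rewrite /upto/=; first by move=> [h1 /negP h2]; lia.
by move=> ->; split => //; apply/negP; lia.
Qed.

Lemma sigma_weight_gt1 v p n : 1 < p -> nonneg_seq v ->
  epow (sigma v p n) (- p) = ((dual_sum v p n `^ (p - 1))^-1)%E.
Proof.
move=> p1 v0; have p0 : 0 < p by lra.
rewrite epow_inv// /sigma gt_eqF// epowE ?invr_ge0; last by rewrite divr_ge0; lra.
rewrite -poweRrM; congr ((_ `^ _)^-1)%E.
by rewrite invf_div divfK// gt_eqF.
Qed.

Lemma sigma_weight_oo v p n : 1 < p -> nonneg_seq v ->
  dual_sum v p n = +oo%E -> epow (sigma v p n) (- p) = 0%E.
Proof.
move=> p1 v0 h; rewrite sigma_weight_gt1// h poweRyr ?invey// gt_eqF; lra.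
Qed.

Lemma sigma_weight_fin v p n (V : R) : 1 < p -> nonneg_seq v ->
  dual_sum v p n = V%:E -> 0 < V /\ epow (sigma v p n) (- p) = (V `^ (1 - p))%:E.
Proof.
move=> p1 v0 h; have V0 : 0 < V by rewrite -lte_fin -h dual_sum_gt0.
split=> //; rewrite sigma_weight_gt1// h poweR_EFin inver gt_eqF ?powR_gt0//.
by rewrite -powRN opprB.
Qed.

Lemma sigma1 v n : nonneg_seq v ->
  epow (sigma v 1 n) (- 1) = ((ereal_sup [set ((v i)%:E)^-1 | i in upto n])^-1)%E.
Proof.
move=> v0; rewrite epow_inv// /sigma eqxx.
rewrite (_ : (fun i => epow (v i)%:E (-1)) = (fun i => ((v i)%:E)^-1)%E).
  rewrite poweRe1//; apply: le_ereal_sup_tmp; exists ((v n)%:E^-1)%E.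
    by exists n => //; rewrite /upto/=.
  by rewrite inve_ge0 lee_fin.
by apply/funext => i; rewrite epow_inv// poweRe1// lee_fin.
Qed.

Lemma sigma_weightP v p n : 1 <= p -> nonneg_seq v ->
  epow (sigma v p n) (- p) = (sigma_weight v p n)%:E /\ 0 <= sigma_weight v p n.
Proof.
move=> p1 v0; rewrite /sigma_weight.
suff [x x0 ->] : exists2 x : R, 0 <= x & epow (sigma v p n) (- p) = x%:E by [].
move: p1; rewrite le_eqVlt => /predU1P[<-|p1]; last first.
  case E : (dual_sum v p n) => [V| |].
  - have [V0 ->] := sigma_weight_fin p1 v0 E; exists (V `^ (1 - p)) => //.
    exact: powR_ge0.
  - by rewrite sigma_weight_oo//; exists 0.
  - by have := dual_sum_gt0 n p1 v0; rewrite E.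
rewrite sigma1//; set S := ereal_sup _.
have S0 : (0 < S)%E.
  apply: (@lt_le_trans _ _ ((v n)%:E^-1)%E); last first.
    by apply: ereal_sup_ubound; exists n => //; rewrite /upto/=.
  rewrite inver; case: eqP => [_|/eqP vn]; first exact: ltry.
  by rewrite lte_fin invr_gt0 lt_def vn v0.
case: S S0 => [s| |//] S0; last by exists 0.
exists s^-1; first by rewrite invr_ge0 -lee_fin ltW.
by rewrite inver gt_eqF// -lte_fin.
Qed.

Lemma sigma_weight_ge0 v p n : 1 <= p -> nonneg_seq v -> 0 <= sigma_weight v p n.
Proof. by move=> p1 v0; case: (sigma_weightP n p1 v0). Qed.

(** The pointwise form of the estimate of [sigma]-weighted increments of
    [A `^ p] by [a `^ p * v], where [x] is the previous partial sum and [x + y]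
    the next one.  For [p = 1] it says that [sigma_weight v 1 n <= v n]; for
    [1 < p] it is [hardy_step], except where the dual weight has an infinite sum
    and the weight vanishes. *)
Lemma sigma_weight_step p : 1 <= p -> exists k K : R, [/\ 0 <= k, 0 < K &
  forall v n x y, nonneg_seq v -> 0 <= x -> 0 <= y ->
  (1 + k) * (sigma_weight v p n * (x + y) `^ p) <=
    K * (y `^ p * v n) +
    (sigma_weight v p n + k * sigma_weight v p (n - 1)) * x `^ p].
Proof.
rewrite le_eqVlt => /predU1P[<-|p1].
  exists 0, 1; split => // v n x y v0 x0 y0.
  rewrite !powRr1 ?addr_ge0// addr0 !mul1r mul0r addr0 mulrDr addrC lerD2r.
  rewrite mulrC ler_wpM2l// -lee_fin -(sigma_weightP n (lexx 1) v0).1 sigma1//.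
  rewrite inve_ple ?inE/= ?lee_fin//; last first.
    apply: le_ereal_sup_tmp; exists ((v n)%:E^-1)%E; last by rewrite inve_ge0 lee_fin.
    by exists n => //; rewrite /upto/=.
  by apply: ereal_sup_ubound; exists n => //; rewrite /upto/=.
have p1' := ltW p1.
have k0 : 0 < (p - 1)^-1 by rewrite invr_gt0; lra.
exists (p - 1)^-1, ((p + p / (p - 1)) `^ p); split => [||v n x y v0 x0 y0].
- exact: ltW.
- by rewrite powR_gt0// addr_gt0 ?mulr_gt0//; lra.
have [e1 s0] := sigma_weightP n p1' v0.
have [e2 s0'] := sigma_weightP (n - 1) p1' v0.
case E : (dual_sum v p n) => [V| |]; last first.
- by have := dual_sum_gt0 n p1 v0; rewrite E.
- have -> : sigma_weight v p n = 0.
    by apply/eqP; rewrite -eqe -e1 sigma_weight_oo.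
  rewrite mul0r mulr0 add0r addr_ge0// !mulr_ge0 ?powR_ge0 ?addr_ge0 ?v0//.
  exact: ltW.
have [V0 e1'] := sigma_weight_fin p1 v0 E.
have {e1 e1'}-> : sigma_weight v p n = V `^ (1 - p).
  by apply/eqP; rewrite -eqe -e1 e1'.
have : dual_sum v p n \is a fin_num by rewrite E.
rewrite dual_sum_rec fin_numD => /andP[/fineK E1 /fineK E2].
have [W0 e2'] := sigma_weight_fin p1 v0 (esym E1).
have {e2 e2'}-> : sigma_weight v p (n - 1) = fine (dual_sum v p (n - 1)) `^ (1 - p).
  by apply/eqP; rewrite -eqe -e2 e2'.
have vn : 0 < v n.
  rewrite lt_def v0 andbT; apply/eqP => vn.
  by move: E2; rewrite dual0.
have VE : V = fine (dual_sum v p (n - 1)) + v n `^ (1 - p / (p - 1)).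
  by apply/eqP; rewrite -eqe EFinD E1 -dual_gt0// -dual_sum_rec E.
have := @hardy_step _ p p1 (fine (dual_sum v p (n - 1)))
  (v n `^ (1 - p / (p - 1))) x y W0 (powR_gt0 _ vn) x0 y0.
rewrite -VE -powRrM; set z := (X in v n `^ X).
have -> : z = 1 by rewrite /z; field; rewrite subr_eq0 gt_eqF.
by rewrite powRr1.
Qed.

(** [sigma_weight v p n] is the infimum of the costs [\sum a j `^ p * v j] of unit
    masses on [j <= n].  For [1 < p] a mass proportional to the dual weight on a large
    finite set is almost optimal; where [v] vanishes, and for [p = 1], one atom
    suffices. *)
Lemma sigma_weight_extremal v p n e : 1 <= p -> nonneg_seq v ->
  sigma_weight v p n < e ->
  exists (r : seq int) a, [/\ uniq r, forall j, j \in r -> j <= n,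
    nonneg_seq a, forall j, j \notin r -> a j = 0 &
    \sum_(j <- r) a j = 1 /\ \sum_(j <- r) a j `^ p * v j <= e].
Proof.
move=> p1 v0 se.
have e0 : 0 < e by apply: le_lt_trans se; exact: sigma_weight_ge0.
have p0 : p != 0 by rewrite gt_eqF//; lra.
have point i : i <= n -> v i <= e ->
  exists (r : seq int) a, [/\ uniq r, forall j, j \in r -> j <= n,
    nonneg_seq a, forall j, j \notin r -> a j = 0 &
    \sum_(j <- r) a j = 1 /\ \sum_(j <- r) a j `^ p * v j <= e].
  move=> il vi; exists [:: i], (fun j => (j == i)%:R); split => //.
  - by move=> j; rewrite inE => /eqP ->.
  - by move=> j; rewrite inE => /negPf ->.
  - by rewrite !big_seq1 eqxx powR1 mul1r.
move: p1; rewrite le_eqVlt => /predU1P[p1E|p1].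
  subst p.
  have [[i ni vi]|H] := pselect (exists2 i, i <= n & v i <= e); first exact: (point i).
  exfalso; move: se; rewrite -lte_fin -(sigma_weightP n (lexx 1) v0).1 sigma1//.
  apply/negP; rewrite -leNgt.
  have S0 : (0 <= ereal_sup [set ((v i)%:E)^-1%E | i in upto n])%E.
    apply: le_ereal_sup_tmp; exists ((v n)%:E^-1)%E; last by rewrite inve_ge0 lee_fin.
    by exists n => //; rewrite /upto/=.
  rewrite -[leLHS]inveK lee_pV2 ?inE/= ?inve_ge0 ?lee_fin ?(ltW e0)//.
  apply: ge_ereal_sup => _ [i ni <-].
  rewrite lee_pV2 ?inE/= ?lee_fin ?(ltW e0)// leNgt; apply/negP => vi.
  by apply: H; exists i => //; exact: ltW.
have [[i [ni vi]]|H] := pselect (exists i, i <= n /\ v i = 0).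
  by apply: (point i) => //; rewrite vi ltW.
have vp i : i <= n -> 0 < v i.
  move=> ni; rewrite lt_def v0 andbT; apply/eqP => vi; apply: H.
  by exists i.
pose t := e `^ (1 - p)^-1.
have t0 : 0 < t by rewrite powR_gt0.
have te : t `^ (1 - p) = e.
  by rewrite /t -powRrM mulVf ?powRr1 ?(ltW e0)//; lra.
pose d j := v j `^ (1 - p / (p - 1)).
have tV : (t%:E < dual_sum v p n)%E.
  case E : (dual_sum v p n) => [V| |]; last first.
  - by have := dual_sum_gt0 n p1 v0; rewrite E.
  - exact: ltry.
  have [V0 e1'] := sigma_weight_fin p1 v0 E.
  have sE : sigma_weight v p n = V `^ (1 - p).
    by apply/eqP; rewrite -eqe -(sigma_weightP n (ltW p1) v0).1 e1'.
  rewrite lte_fin ltNge; apply/negP => Vt.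
  move: se; rewrite sE -te; apply/negP; rewrite -leNgt -(opprB p) !powRN.
  rewrite lef_pV2 ?posrE ?powR_gt0// ge0_ler_powR// ?nnegrE ?(ltW V0) ?(ltW t0)//.
  lra.
have [r [ur rn tX]] := esum_gt tV.
have dE : (\sum_(j <- r) dual v p j = (\sum_(j <- r) d j)%:E)%E.
  rewrite -sumEFin big_seq [RHS]big_seq; apply: eq_bigr => j /rn jn.
  by rewrite dual_gt0// vp.
rewrite dE lte_fin in tX.
set D := \sum_(j <- r) d j in tX dE.
have D0 : 0 < D by exact: lt_trans tX.
exists r, (fun j => if j \in r then d j / D else 0); split => //.
- by move=> j; case: ifP => // _; rewrite divr_ge0 ?powR_ge0// ltW.
- by move=> j /negPf ->.
split.
  rewrite big_seq (eq_bigr (fun j => d j / D)) => [|j ->//].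
  by rewrite -big_seq -mulr_suml divff// gt_eqF.
rewrite big_seq (eq_bigr (fun j => d j * (D^-1 `^ p))) => [|j jr]; last first.
  rewrite jr powRM ?powR_ge0 ?invr_ge0 ?(ltW D0)// mulrAC; congr (_ * _).
  rewrite /d -powRrM -[X in _ * X]powRr1 ?v0//.
  rewrite -powRD; last by apply/implyP => _; rewrite gt_eqF// vp// rn.
  by congr powR; field; rewrite subr_eq0 gt_eqF.
rewrite -big_seq -mulr_suml -/D -te.
have -> : D * D^-1 `^ p = D `^ (1 - p).
  rewrite powRD ?powRr1 ?(ltW D0)//; last by apply/implyP => _; rewrite gt_eqF.
  by congr (_ * _); rewrite -powR_inv1 ?(ltW D0)// -powRrM mulN1r.
rewrite -(opprB p) !powRN lef_pV2 ?posrE ?powR_gt0//.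
by rewrite ge0_ler_powR// ?nnegrE ?(ltW D0) ?(ltW t0) ?(ltW tX)//; lra.
Qed.

End sigma_weight.

Lemma sigma_normE (R : realType) (p : R) v a : 1 <= p -> nonneg_seq v ->
  sigma_norm p v a = ((esum [set: int]
    (fun n => (sigma_weight v p n * a n `^ p)%:E)) `^ p^-1)%E.
Proof.
move=> p1 v0; have p0 : 0 <= p by lra.
rewrite /sigma_norm epowE ?invr_ge0//; congr (_ `^ _)%E.
apply: eq_esum => n _; rewrite (sigma_weightP n p1 v0).1 epowE//.
Qed.

Lemma sigma_norm_ge0 (R : realType) (p : R) v a : (0 <= sigma_norm p v a)%E.
Proof. by rewrite /sigma_norm /epow; case: ifP; rewrite ?inve_ge0 poweR_ge0. Qed.

(** * Sequences of finite support *)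

Lemma sum_supp (R : realType) (T : eqType) (r s : seq T) (f : T -> R) :
  uniq r -> uniq s -> {subset r <= s} -> (forall i, i \notin r -> f i = 0) ->
  \sum_(i <- s) f i = \sum_(i <- r) f i.
Proof.
move=> ur us rs f0; rewrite (bigID (mem r))/= [X in _ + X]big1 ?addr0//.
rewrite -big_filter; apply/perm_big/uniq_perm; rewrite ?filter_uniq// => i.
by rewrite mem_filter; case: (boolP (i \in r)) => //= /rs.
Qed.

Definition trunc (R : realType) (N : nat) (a : int -> R) (n : int) : R :=
  if (`|n| <= N)%N then a n else 0.

Lemma trunc_ge0 (R : realType) N (a : int -> R) : nonneg_seq a ->
  nonneg_seq (trunc N a).
Proof. by move=> a0 n; rewrite /trunc; case: ifP. Qed.

Lemma trunc_le (R : realType) N (a : int -> R) n : nonneg_seq a -> trunc N a n <= a n.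
Proof. by move=> a0; rewrite /trunc; case: ifP. Qed.

Lemma trunc_mono (R : realType) N M (a : int -> R) n : nonneg_seq a ->
  (N <= M)%N -> trunc N a n <= trunc M a n.
Proof.
move=> a0 NM; rewrite /trunc; case: ifP => [nN|_]; last by case: ifP.
by rewrite (leq_trans nN NM).
Qed.

Lemma esum_trunc_le (R : realType) (D : set int) (a : int -> R)
    (F : int -> R -> \bar R) (x : \bar R) :
  (forall N, esum D (fun i => F i (trunc N a i)) <= x)%E ->
  (esum D (fun i => F i (a i)) <= x)%E.
Proof.
move=> H; apply: esum_le => l ul lD.
pose N := (\max_(i <- l) `|i|)%N.
apply: le_trans (H N); apply: le_trans (le_sum_esum _ ul lD).
rewrite big_seq [leRHS]big_seq le_eqVlt; apply/orP; left; apply/eqP.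
by apply: eq_bigr => i il; rewrite /trunc ifT// leq_bigmax_seq.
Qed.

Lemma sup_trunc_le (R : realType) (U : int -> R) (n : int)
    (a : int -> R) (F : R -> \bar R) (x : \bar R) :
  (forall i, 0 <= U i) -> nonneg_seq a -> (forall z, 0 <= z -> (0 <= F z)%E) ->
  (forall N, ereal_sup [set (U i)%:E * esum (upto i) (fun j => F (trunc N a j))
     | i in upto n] <= x)%E ->
  (ereal_sup [set (U i)%:E * esum (upto i) (fun j => F (a j)) | i in upto n]
     <= x)%E.
Proof.
move=> U0 a0 F0 H.
have H' N i : i <= n ->
    ((U i)%:E * esum (upto i) (fun j => F (trunc N a j)) <= x)%E.
  by move=> ni; apply: le_trans (H N); apply: ereal_sup_ubound; exists i.
apply: ge_ereal_sup => _ [i ni <-].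
have x0 : (0 <= x)%E.
  apply: le_trans (H' 0%N i ni); rewrite mule_ge0 ?lee_fin//.
  by apply: esum_ge0 => j _; rewrite F0// trunc_ge0.
case: (ltgtP 0 (U i)) (U0 i) => // [Ui _|<- _]; last by rewrite mul0e.
rewrite -lee_pdivlMl//; apply: (@esum_trunc_le _ _ a (fun _ z => F z)) => N.
by rewrite lee_pdivlMl// H'.
Qed.

(** Enumerates the integers from [- N], so that sums of sequences supported
    there become sums over natural numbers. *)
Definition idx (N k : nat) : int := k%:Z - N%:Z.

Lemma idx_inj N : injective (idx N).
Proof. by move=> i j; rewrite /idx; lia. Qed.

Lemma idx_surj N (i : int) : - N%:Z <= i -> exists k, i = idx N k.
Proof. by move=> Ni; exists (absz (i + N%:Z)); rewrite /idx; lia. Qed.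

Lemma idx_ltN N k : (idx N k < - N%:Z) = false.
Proof. by apply/negbTE; rewrite -leNgt /idx; lia. Qed.

Lemma idxK N k : absz (idx N k + N%:Z) = k.
Proof. by rewrite /idx; lia. Qed.

Lemma trunc_ltN (R : realType) N (a : int -> R) j : j < - N%:Z -> trunc N a j = 0.
Proof. by move=> jN; rewrite /trunc ifF//; apply/negbTE; rewrite -ltnNge; lia. Qed.

Lemma trunc_idx_gt (R : realType) N (a : int -> R) k : (N.*2 < k)%N ->
  trunc N a (idx N k) = 0.
Proof.
by move=> kN; rewrite /trunc ifF//; apply/negbTE; rewrite -ltnNge /idx; lia.
Qed.

Lemma idx_le N i j : (i <= j)%N -> idx N i <= idx N j.
Proof. by rewrite /idx; lia. Qed.

Lemma abs_idx_le N k : (k < N.*2.+1)%N -> (absz (idx N k) <= N)%N.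
Proof. by rewrite /idx; lia. Qed.

Lemma abs_le_idx N (n : int) : (absz n <= N)%N ->
  exists2 k, (k < N.*2.+1)%N & n = idx N k.
Proof. by move=> nN; exists (absz (n + N%:Z)); rewrite /idx; lia. Qed.

Lemma esum_idx (R : realType) (N L : nat) (f : int -> \bar R) (D : set int) :
  (forall i, 0 <= f i)%E ->
  (forall i, D i -> (forall k, (k < L)%N -> i <> idx N k) -> f i = 0%E) ->
  (forall k, (k < L)%N -> D (idx N k)) ->
  esum D f = (\sum_(0 <= k < L) f (idx N k))%E.
Proof.
move=> f0 fz DL; rewrite (@esum_supp _ _ D f (map (idx N) (index_iota 0 L)))//.
- rewrite big_map big_seq_cond [RHS]big_seq; apply: eq_bigl => k.
  rewrite mem_index_iota/=; case: (ltnP k L) => //= kL.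
  exact/mem_set/DL.
- by rewrite map_inj_uniq ?iota_uniq//; exact: idx_inj.
- move=> i Di iN; apply: fz => // k kL ik; move/negP: iN; apply; rewrite ik.
  by rewrite map_f// mem_index_iota.
Qed.

Lemma esum_upto_idx (R : realType) (N k : nat) (f : int -> \bar R) :
  (forall i, 0 <= f i)%E -> (forall i, i < - N%:Z -> f i = 0%E) ->
  esum (upto (idx N k)) f = (\sum_(0 <= j < k.+1) f (idx N j))%E.
Proof.
move=> f0 fz; apply: esum_idx => // [i|j jk]; last first.
  by rewrite /upto /idx/=; lia.
rewrite /upto /idx/= => ik H; apply: fz; rewrite ltNge; apply/negP => Ni.
by apply: (H (absz (i + N%:Z))); lia.
Qed.

Lemma esum_upto_lt (R : realType) (N : nat) (f : int -> \bar R) i :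
  i < - N%:Z -> (forall i, i < - N%:Z -> f i = 0%E) ->
  esum (upto i) f = 0%E.
Proof.
by move=> iN fz; apply: esum1 => j; rewrite /upto/= => ji; apply: fz; lia.
Qed.

(** * The implications between the three inequalities *)

(** [U] decreases in its first variable, so that the rectangle with corner [i] lies
    below the sum. *)
Lemma ineq_ii_iii (R : realType) (p q : R) v w U C :
  1 <= p -> 0 < q -> nonneg_seq w ->
  (forall i n, 0 <= U i n) -> (forall i j n, i <= j -> U j n <= U i n) ->
  ineq_ii p q v w U C -> ineq_iii p q v w U C.
Proof.
move=> p1 q0 w0 U0 Uanti H a a0; apply: le_trans (H a a0).
have p0 : 0 < p by lra. have qp : 0 < q / p by rewrite divr_gt0.
apply: le_weighted_norm => // n; apply: le_poweR; first exact: ltW.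
  apply: le_ereal_sup_tmp; eexists; first by exists n => //; rewrite /upto/=.
  by rewrite mule_ge0 ?epowE ?poweR_ge0// ?esum_ge0 ?(ltW p0)// => i _; rewrite epowE ?poweR_ge0// ltW.
apply: ge_ereal_sup => _ [i ni <-].
rewrite epowE ?(ltW p0)// poweR_EFin.
rewrite esumZl ?powR_ge0//; last by move=> j; rewrite epowE ?poweR_ge0// ltW.
rewrite esum_mkcond [leRHS]esum_mkcond; apply: le_esum => j _.
case: ifPn => [/set_mem ij|_]; last first.
  by case: ifP => // _; rewrite mule_ge0 ?epowE ?poweR_ge0// ltW.
rewrite ifT; last by apply/mem_set; move: ij ni; rewrite /upto/=; lia.
rewrite !epowE ?(ltW p0)// lee_wpmul2r ?poweR_ge0// poweR_EFin lee_fin.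
by rewrite ge0_ler_powR ?nnegrE ?(ltW p0)// Uanti.
Qed.

(** Hardy's inequality, stated for the increments of the [p]th powers of the
    partial sums.  The induction carries along the boundary term left by
    [sigma_weight_step], which is nonnegative. *)
Lemma hardy_telescope (R : realType) (p : R) : 1 <= p -> exists2 K : R, 0 < K &
  forall (v : int -> R) (a : nat -> R) (N L : nat), nonneg_seq v ->
    (forall k, 0 <= a k) ->
    \sum_(0 <= k < L) sigma_weight v p (idx N k) *
      ((\sum_(0 <= j < k.+1) a j) `^ p - (\sum_(0 <= j < k) a j) `^ p) <=
      K * \sum_(0 <= k < L) a k `^ p * v (idx N k).
Proof.
move=> p1; have p0 : 0 < p by lra.
have [k [K [k0 K0 step]]] := sigma_weight_step p1.
exists K => // v a N L v0 a0; pose A k := \sum_(0 <= j < k) a j.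
have A0 j : 0 <= A j by apply: sumr_ge0.
have s0 n := sigma_weight_ge0 n p1 v0.
have main : \sum_(0 <= j < L) sigma_weight v p (idx N j) * (A j.+1 `^ p - A j `^ p)
      + k * (sigma_weight v p (idx N L - 1) * A L `^ p) <=
    K * \sum_(0 <= j < L) a j `^ p * v (idx N j).
  elim: L => [|L IH].
    by rewrite !big_geq// /A big_geq// powR0 ?gt_eqF// !mulr0 addr0.
  rewrite !big_nat_recr//= mulrDr.
  have -> : idx N L.+1 - 1 = idx N L by rewrite /idx; lia.
  have := step v (idx N L) (A L) (a L) v0 (A0 L) (a0 L).
  have -> : A L + a L = A L.+1 by rewrite /A big_nat_recr.
  move: IH; lra.
by apply: le_trans main; rewrite lerDl mulr_ge0// mulr_ge0 ?powR_ge0.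
Qed.

(** (iii) is applied to [b] with [b `^ p] the increments of the [p]th powers of
    the partial sums of [a]: then the two left-hand sides coincide, and
    [hardy_telescope] compares the right-hand sides. *)
Lemma ineq_iii_i (R : realType) (p q : R) : 1 <= p -> 0 < q ->
  exists2 K : R, 0 < K & forall v w U C,
  nonneg_seq v -> nonneg_seq w -> (forall i n, 0 <= U i n) -> 0 <= C ->
  ineq_iii p q v w U C -> ineq_i p q v w U (K * C).
Proof.
move=> p1 q0; have p0 : 0 < p by lra.
have pV0 : 0 < p^-1 by rewrite invr_gt0.
have [p0' q0' pV0'] : [/\ 0 <= p, 0 <= q & 0 <= p^-1] by split; apply: ltW.
have qp : 0 < q / p by rewrite divr_gt0.
have [K K0 tele] := hardy_telescope p1.
exists (K `^ p^-1); first by rewrite powR_gt0.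
move=> v w U C v0 w0 U0 C0 H a a0.
set B := (_ * epow _ _)%E.
have B0 : (0 <= B)%E.
  by rewrite /B (epowE _ pV0') mule_ge0 ?poweR_ge0// lee_fin mulr_ge0 ?powR_ge0.
have sup0 (b : int -> R) n : nonneg_seq b -> (0 <= ereal_sup
    [set (U i n)%:E * esum (upto i) (fun j => (b j)%:E) | i in upto n])%E.
  move=> b0; apply: le_ereal_sup_tmp; eexists; first by exists n => //; rewrite /upto/=.
  by rewrite mule_ge0 ?lee_fin ?U0// esum_ge0// => i _; rewrite lee_fin.
apply: (@weighted_norm_sup_le _ _ _ (fun N n => ereal_sup
    [set (U i n)%:E * esum (upto i) (fun j => (trunc N a j)%:E) | i in upto n])%E) => //.
- by move=> n; exact: sup0.
- move=> n x; exact: (@sup_trunc_le _ (U ^~ n) n a EFin).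
- by move=> N n; apply: sup0; exact: trunc_ge0.
- move=> N M n NM; apply: ge_ereal_sup => _ [i ni <-].
  apply: le_ereal_sup_tmp; eexists; first by exists i.
  rewrite lee_wpmul2l ?lee_fin//; apply: le_esum => j _.
  by rewrite lee_fin trunc_mono.
move=> N; set a' := trunc N a.
have a'0 : nonneg_seq a' by exact: trunc_ge0.
pose A k := \sum_(0 <= j < k) a' (idx N j).
have A0 k : 0 <= A k by apply: sumr_ge0.
have Am k : A k `^ p <= A k.+1 `^ p.
  by rewrite ge0_ler_powR ?nnegrE// /A big_nat_recr//= lerDl.
pose b n := if n < - N%:Z then 0 else
  (A (absz (n + N%:Z)).+1 `^ p - A (absz (n + N%:Z)) `^ p) `^ p^-1.
have b0 : nonneg_seq b by move=> n; rewrite /b; case: ifP => // _; exact: powR_ge0.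
have bE k : b (idx N k) `^ p = A k.+1 `^ p - A k `^ p.
  rewrite /b idx_ltN idxK.
  by rewrite -powRrM mulVf ?gt_eqF// powRr1// subr_ge0.
have partial i : esum (upto i) (fun j => epow (b j)%:E p) =
    (esum (upto i) (fun j => (a' j)%:E) `^ p)%E.
  have e0 j : (0 <= epow (b j)%:E p)%E by rewrite epowE ?poweR_ge0.
  have ez j : j < - N%:Z -> epow (b j)%:E p = 0%E.
    by move=> jN; rewrite epowE// /b jN poweR0r// gt_eqF.
  have az j : j < - N%:Z -> (a' j)%:E = 0%E :> \bar R.
    by move=> jN; rewrite /a' trunc_ltN.
  case: (ltP i (- N%:Z)) => [iN|/idx_surj[k ->]].
    by rewrite !(esum_upto_lt iN)// poweR0r// gt_eqF.
  have a'0e j : (0 <= (a' j)%:E)%E by rewrite lee_fin.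
  rewrite !esum_upto_idx//.
  rewrite (eq_bigr (fun j => (A j.+1 `^ p - A j `^ p)%:E)); last first.
    by move=> j _; rewrite epowE// poweR_EFin bE.
  rewrite !sumEFin poweR_EFin telescope_sumr//.
  by rewrite {2}/A big_geq// powR0 ?gt_eqF// subr0.
have cost : (sigma_norm p v b <= (K `^ p^-1)%:E *
    epow (esum [set: int] (fun n => epow (a n)%:E p * (v n)%:E)) p^-1)%E.
  have X0 : (0 <= esum [set: int] (fun n => epow (a n)%:E p * (v n)%:E))%E.
    by apply: esum_ge0 => n _; rewrite mule_ge0 ?lee_fin// epowE ?poweR_ge0.
  rewrite sigma_normE// (epowE _ pV0') -poweR_EFin -poweRM ?lee_fin ?(ltW K0)//.
  have s0 n := sigma_weight_ge0 n p1 v0.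
  apply: le_poweR => //.
    by apply: esum_ge0 => n _; rewrite lee_fin mulr_ge0 ?powR_ge0.
  rewrite (@esum_idx _ N N.*2.+1)//; last 2 first.
  - by move=> n; rewrite lee_fin mulr_ge0 ?powR_ge0.
  - move=> n _ nN; congr EFin; rewrite /b; case: ifPn => [_|].
      by rewrite powR0 ?gt_eqF// mulr0.
    rewrite -leNgt => /idx_surj[k nk]; subst n.
    rewrite idxK.
    rewrite /A big_nat_recr//= [a' (idx N k)](_ : _ = 0).
      by rewrite addr0 subrr !powR0 ?gt_eqF// mulr0.
    have kN : (N.*2 < k)%N by rewrite ltnNge; apply/negP => kN; apply: (nN k).
    exact: trunc_idx_gt.
  rewrite (eq_bigr (fun k => (sigma_weight v p (idx N k) *
      (A k.+1 `^ p - A k `^ p))%:E)); last by move=> k _; rewrite bE.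
  rewrite sumEFin; apply: (@le_trans _ _ (K * \sum_(0 <= k < N.*2.+1)
      a' (idx N k) `^ p * v (idx N k))%:E).
    rewrite lee_fin; apply: (tele v (fun k => a' (idx N k))) => // k.
  rewrite EFinM lee_wpmul2l ?lee_fin ?(ltW K0)// -sumEFin.
  apply: (@le_trans _ _ (\sum_(0 <= k < N.*2.+1)
      epow (a (idx N k))%:E p * (v (idx N k))%:E)%E).
    apply: lee_sum => k _; rewrite epowE// poweR_EFin -EFinM lee_fin.
    by rewrite ler_wpM2r// ge0_ler_powR ?nnegrE// trunc_le.
  have := @le_sum_esum _ _ [set: int] (fun n => epow (a n)%:E p * (v n)%:E)%E
    (map (idx N) (index_iota 0 N.*2.+1)).
  rewrite big_map; apply => //.
  by rewrite map_inj_uniq ?iota_uniq//; exact: idx_inj.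
apply: (@le_trans _ _ (C%:E * sigma_norm p v b)%E); last first.
  by rewrite /B [K `^ _ * C]mulrC EFinM -muleA lee_wpmul2l ?lee_fin.
apply: le_trans (H b b0).
apply: le_weighted_norm => // n.
have Y0 i : (0 <= esum (upto i) (fun j => (a' j)%:E))%E.
  by apply: esum_ge0 => j _; rewrite lee_fin.
rewrite [q / p]mulrC poweRrM; apply: le_poweR => //; first exact: sup0.
apply: ge_ereal_sup => _ [i ni <-].
rewrite -[leLHS](poweRK p0) ?mule_ge0 ?lee_fin//.
apply: le_poweR; rewrite ?poweR_ge0//.
apply: ereal_sup_ubound; exists i => //.
by rewrite partial epowE// poweRM// lee_fin.
Qed.

(** (i) is applied to the [l^p] superposition [A] of almost optimal unit masses
    [x k] on [j <= k], with coefficients [b k].  The cost is additive, and by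
    [minkowski_sum_ge] the partial sums of [A] up to [i] are at least those of
    [b] in [l^p].  No constant is lost since the error [e] tends to 0. *)
Lemma ineq_i_iii (R : realType) (p q : R) v w U C : 1 <= p -> 0 < q ->
  nonneg_seq v -> nonneg_seq w -> (forall i n, 0 <= U i n) -> 0 <= C ->
  ineq_i p q v w U C -> ineq_iii p q v w U C.
Proof.
move=> p1 q0 v0 w0 U0 C0 H b b0; have p0 : 0 < p by lra.
have pV0 : 0 < p^-1 by rewrite invr_gt0.
have [p0' q0' pV0'] : [/\ 0 <= p, 0 <= q & 0 <= p^-1] by split; apply: ltW.
have qp : 0 < q / p by rewrite divr_gt0.
have s0 n := sigma_weight_ge0 n p1 v0.
have UE (c : int -> R) n : [set epow (U i n)%:E p *
      esum (upto i) (fun j => epow (c j)%:E p) | i in upto n]%E =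
    [set (U i n `^ p)%:E * esum (upto i) (fun j => (c j `^ p)%:E) | i in upto n]%E.
  congr image; apply/funext => i; rewrite epowE//; congr (_ * _)%E.
  by apply: eq_esum => j _; rewrite epowE.
rewrite [X in weighted_norm _ X](_ : _ = fun n => ereal_sup
    [set (U i n `^ p)%:E * esum (upto i) (fun j => (b j `^ p)%:E) | i in upto n]%E);
  last by apply/funext => n; rewrite UE.
have sup0 (c : int -> R) n : (0 <= ereal_sup [set (U i n `^ p)%:E *
    esum (upto i) (fun j => (c j `^ p)%:E) | i in upto n])%E.
  apply: le_ereal_sup_tmp; eexists; first by exists n => //; rewrite /upto/=.
  by rewrite mule_ge0 ?lee_fin ?powR_ge0// esum_ge0// => i _; rewrite lee_fin powR_ge0.
apply: (@weighted_norm_sup_le _ _ _ (fun N n => ereal_sup [set (U i n `^ p)%:E *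
    esum (upto i) (fun j => (trunc N b j `^ p)%:E) | i in upto n])%E).
- exact: qp.
- exact: q0.
- exact: w0.
- by rewrite mule_ge0 ?lee_fin ?sigma_norm_ge0.
- by move=> n; exact: sup0.
- move=> n x; apply: (@sup_trunc_le _ (fun i => U i n `^ p) n b (fun z => (z `^ p)%:E)) => //.
  + by move=> i; exact: powR_ge0.
  + by move=> z _; rewrite lee_fin powR_ge0.
- by move=> N n; exact: sup0.
- move=> N M n NM; apply: ge_ereal_sup => _ [i ni <-].
  apply: le_ereal_sup_tmp; eexists; first by exists i.
  rewrite lee_wpmul2l ?lee_fin ?powR_ge0//; apply: le_esum => j _.
  by rewrite lee_fin ge0_ler_powR ?nnegrE ?trunc_ge0 ?trunc_mono//.
move=> N; set b' := trunc N b.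
pose W := map (idx N) (index_iota 0 N.*2.+1).
have uW : uniq W by rewrite map_inj_uniq ?iota_uniq//; exact: idx_inj.
have b'W k : k \notin W -> b' k = 0.
  case: (ltP k (- N%:Z)) => [kN _|/idx_surj[j ->] jW]; first exact: trunc_ltN.
  apply: trunc_idx_gt; rewrite ltnNge; apply/negP => jN; move/negP: jW; apply.
  by rewrite map_f// mem_index_iota.
have b'0 : nonneg_seq b' by exact: trunc_ge0.
set wn := weighted_norm _ _ _ _.
have wn0 : (0 <= wn)%E.
  by rewrite /wn /weighted_norm epowE ?poweR_ge0// invr_ge0 ltW.
pose y := \sum_(k <- W) b' k `^ p * sigma_weight v p k.
pose z := \sum_(k <- W) b' k `^ p.
have y0 : 0 <= y by apply: sumr_ge0 => k _; rewrite mulr_ge0 ?powR_ge0.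
have z0 : 0 <= z by apply: sumr_ge0 => k _; rewrite powR_ge0.
apply: (@le_trans _ _ (C * y `^ p^-1)%:E); last first.
  rewrite EFinM lee_wpmul2l ?lee_fin// sigma_normE// -poweR_EFin.
  apply: le_poweR; rewrite ?lee_fin// /y -sumEFin.
  apply: le_trans (@le_sum_esum _ _ _ _ W uW _); last by [].
  apply: lee_sum => k _; rewrite lee_fin mulrC ler_wpM2l//.
  by rewrite ge0_ler_powR ?nnegrE// trunc_le.
apply: (@eps_root _ p C y z) => // e e0.
(* x k is a unit mass on j <= k with cost at most sigma_weight v p k + e *)
have ext k : exists ra : seq int * (int -> R), [/\ uniq ra.1,
    forall j, j \in ra.1 -> j <= k, nonneg_seq ra.2,
    forall j, j \notin ra.1 -> ra.2 j = 0 &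
    \sum_(j <- ra.1) ra.2 j = 1 /\
    \sum_(j <- ra.1) ra.2 j `^ p * v j <= sigma_weight v p k + e].
  have [|r [a ra]] := @sigma_weight_extremal _ v p k (sigma_weight v p k + e) p1 v0.
    by rewrite ltrDl.
  by exists (r, a).
have {ext}[ra raP] := choice ext.
pose r k := (ra k).1; pose x k := (ra k).2.
have ur k : uniq (r k) by case: (raP k).
have rk k j : j \in r k -> j <= k by case: (raP k) => _ + _ _ _; apply.
have x0 k j : 0 <= x k j by case: (raP k) => _ _ + _ _; apply.
have xr k j : j \notin r k -> x k j = 0 by case: (raP k) => _ _ _ + _; apply.
have x1 k : \sum_(j <- r k) x k j = 1 by case: (raP k) => _ _ _ _ [].
have xc k : \sum_(j <- r k) x k j `^ p * v j <= sigma_weight v p k + e.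
  by case: (raP k) => _ _ _ _ [].
pose S := undup (flatten (map r W)).
have uS : uniq S by exact: undup_uniq.
have rS k : k \in W -> {subset r k <= S}.
  move=> kW j jr; rewrite mem_undup; apply/flattenP; exists (r k) => //.
  exact: map_f.
pose A j := (\sum_(k <- W) b' k `^ p * x k j `^ p) `^ p^-1.
have A0 : nonneg_seq A by move=> j; exact: powR_ge0.
have Ap j : A j `^ p = \sum_(k <- W) b' k `^ p * x k j `^ p.
  rewrite /A -powRrM mulVf ?gt_eqF// powRr1// sumr_ge0// => k _.
  by rewrite mulr_ge0 ?powR_ge0.
have cost : (esum [set: int] (fun n => epow (A n)%:E p * (v n)%:E) <= (y + e * z)%:E)%E.
  rewrite (@esum_supp _ _ _ _ S)//; last 2 first.
  - by move=> j; rewrite epowE// mule_ge0 ?poweR_ge0 ?lee_fin.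
  - move=> j _ jS; rewrite epowE// poweR_EFin Ap big_seq big1 ?mul0e// => k kW.
    rewrite xr; first by rewrite powR0 ?gt_eqF// mulr0.
    by apply: contra jS => /(rS _ kW).
  rewrite (eq_bigl xpredT) => [|j]; last by rewrite in_setT.
  rewrite (eq_bigr (fun j => (\sum_(k <- W) b' k `^ p * (x k j `^ p * v j))%:E)).
    rewrite sumEFin lee_fin exchange_big/= /y /z mulr_sumr -big_split/=.
    rewrite big_seq [leRHS]big_seq ler_sum// => k kW.
    rewrite -mulr_sumr [e * _]mulrC -mulrDr ler_wpM2l ?powR_ge0//.
    rewrite (sum_supp (ur k) uS (rS k kW))// => j jr.
    by rewrite xr// powR0 ?gt_eqF// mul0r.
  move=> j _; rewrite epowE// poweR_EFin Ap -EFinM mulr_suml.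
  by congr EFin; apply: eq_bigr => k _; rewrite mulrA.
apply: (@le_trans _ _ (C%:E * epow (esum [set: int]
    (fun n => epow (A n)%:E p * (v n)%:E)) p^-1)%E); last first.
  rewrite EFinM lee_wpmul2l ?lee_fin// -poweR_EFin epowE//; apply: le_poweR => //.
  by apply: esum_ge0 => j _; rewrite epowE// mule_ge0 ?poweR_ge0 ?lee_fin.
apply: le_trans (H A A0); apply: le_weighted_norm => // n.
have Y0 i : (0 <= esum (upto i) (fun j => (A j)%:E))%E.
  by apply: esum_ge0 => j _; rewrite lee_fin.
have supA0 : (0 <= ereal_sup
    [set (U i n)%:E * esum (upto i) (fun j => (A j)%:E) | i in upto n])%E.
  apply: le_ereal_sup_tmp; eexists; first by exists n => //; rewrite /upto/=.
  by rewrite mule_ge0 ?lee_fin.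
rewrite [q / p]mulrC poweRrM; apply: le_poweR; [exact: q0'|exact: poweR_ge0|].
rewrite poweR_inv_le; [|exact: p0|exact: sup0|exact: supA0].
apply: ge_ereal_sup => _ [i ni <-].
apply: (@le_trans _ _ (((U i n)%:E * esum (upto i) (fun j => (A j)%:E)) `^ p)%E); last first.
  apply: le_poweR; rewrite ?mule_ge0 ?lee_fin//.
  by apply: ereal_sup_ubound; exists i.
rewrite poweRM ?lee_fin// poweR_EFin lee_wpmul2l ?lee_fin ?powR_ge0//.
pose Wi := [seq k <- W | k <= i]; pose Si := [seq j <- S | j <= i].
rewrite (@esum_supp _ _ _ _ W)//; last 2 first.
- by move=> k; rewrite lee_fin powR_ge0.
- by move=> k _ /b'W ->; rewrite powR0 ?gt_eqF.
rewrite (eq_bigl (fun k => k <= i)) => [|k]; last first.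
  by apply/idP/idP => [/set_mem|?] //; apply/mem_set.
rewrite -big_filter -/Wi sumEFin.
have zi0 : 0 <= \sum_(k <- Wi) b' k `^ p by apply: sumr_ge0 => k _; rewrite powR_ge0.
rewrite -poweR_inv_le ?lee_fin// poweR_EFin.
apply: (@le_trans _ _ (\sum_(j <- Si) A j)%:E); last first.
  rewrite -sumEFin; apply: le_sum_esum; first exact: filter_uniq.
  by move=> j; rewrite mem_filter => /andP[].
rewrite lee_fin.
apply: le_trans (@minkowski_sum_ge _ p _ _ Wi Si (fun k => b' k `^ p) x p1 _ x0 _) _.
- by move=> k; exact: powR_ge0.
- move=> k; rewrite mem_filter => /andP[ki kW].
  rewrite (sum_supp (ur k)) ?x1 ?filter_uniq//; last exact: xr.
  by move=> j jr; rewrite mem_filter (rS k)// andbT (le_trans _ ki)// rk.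
apply: ler_sum => j _; rewrite ge0_ler_powR ?nnegrE//.
- by apply: sumr_ge0 => k _; rewrite mulr_ge0 ?powR_ge0.
- by apply: sumr_ge0 => k _; rewrite mulr_ge0 ?powR_ge0.
rewrite big_filter [leRHS](bigID (fun k => k <= i))/= lerDl sumr_ge0// => k _.
by rewrite mulr_ge0 ?powR_ge0.
Qed.

(** [U `^ p] is again a regular kernel, so [sum_le_sup_finite] applies with
    exponent [q / p], kernel [U `^ p] and [c = a `^ p] on a window [- N <= n <= N].
    (iii) is then used for [b] with [b `^ p = c + d], whose cost is at most twice
    that of [a].  The weights are shifted by [e > 0] to make them positive. *)
Lemma ineq_iii_ii (R : realType) (p q c : R) : 1 <= p -> 0 < q -> 0 < c ->
  exists2 K : R, 0 < K & forall v w U C,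
  nonneg_seq v -> nonneg_seq w -> regular_with U c -> 0 <= C ->
  ineq_iii p q v w U C -> ineq_ii p q v w U (K * C).
Proof.
move=> p1 q0 c0; have p0 : 0 < p by lra.
have pV0 : 0 < p^-1 by rewrite invr_gt0.
have [p0' q0' pV0'] : [/\ 0 <= p, 0 <= q & 0 <= p^-1] by split; apply: ltW.
have qp : 0 < q / p by rewrite divr_gt0.
have qp' := ltW qp.
have k0 : 0 <= c `^ p * 2 `^ p by rewrite mulr_ge0 ?powR_ge0.
have [M M0 core] := sum_le_sup_finite qp k0.
(* M compares the left-hand sides, 2 is the cost of b relative to a *)
exists (M `^ q^-1 * 2 `^ p^-1); first by rewrite mulr_gt0 ?powR_gt0.
set K := M `^ q^-1 * 2 `^ p^-1.
have K0 : 0 <= K by rewrite mulr_ge0 ?powR_ge0.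
move=> v w U C v0 w0 [U0 Uanti Umon Ureg] C0 H a a0.
have KC0 : 0 <= K * C by exact: mulr_ge0.
have s0 n := sigma_weight_ge0 n p1 v0.
have UE (b : int -> R) n :
    esum (upto n) (fun i => epow (U i n)%:E p * epow (b i)%:E p)%E =
    esum (upto n) (fun i => (U i n `^ p * b i `^ p)%:E).
  by apply: eq_esum => i _; rewrite !epowE.
rewrite [X in weighted_norm _ X](_ : _ = fun n =>
    esum (upto n) (fun i => (U i n `^ p * a i `^ p)%:E)); last first.
  by apply/funext => n; rewrite UE.
have e0 n (b : int -> R) : (0 <= esum (upto n)
    (fun i => (U i n `^ p * b i `^ p)%:E))%E.
  by apply: esum_ge0 => i _; rewrite lee_fin mulr_ge0 ?powR_ge0.
have emono n N M' : (N <= M')%N ->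
    (esum (upto n) (fun i => (U i n `^ p * trunc N a i `^ p)%:E) <=
     esum (upto n) (fun i => (U i n `^ p * trunc M' a i `^ p)%:E))%E.
  move=> NM; apply: le_esum => i _; rewrite lee_fin ler_wpM2l ?powR_ge0//.
  by rewrite ge0_ler_powR ?nnegrE ?trunc_ge0 ?trunc_mono.
pose g N n : \bar R := if (absz n <= N)%N then
  esum (upto n) (fun i => (U i n `^ p * trunc N a i `^ p)%:E) else 0%E.
have g0 N n : (0 <= g N n)%E by rewrite /g; case: ifP.
apply: (@weighted_norm_sup_le _ _ _ g).
- exact: qp.
- exact: q0.
- exact: w0.
- by apply: mule_ge0; [rewrite lee_fin|exact: sigma_norm_ge0].
- by move=> n; exact: e0.
- move=> n x hx; apply: (@esum_trunc_le _ _ a (fun i z => (U i n `^ p * z `^ p)%:E)) => N.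
  apply: le_trans (hx (maxn N (absz n))); rewrite /g leq_maxr.
  by apply: emono; exact: leq_maxl.
- exact: g0.
- move=> N M' n NM; rewrite /g; case: ifP => [nN|_]; last by case: ifP.
  by rewrite (leq_trans nN NM) emono.
move=> N; set a' := trunc N a; set L := N.*2.+1.
have a'0 : nonneg_seq a' by exact: trunc_ge0.
pose c' k := a' (idx N k) `^ p; pose s k := sigma_weight v p (idx N k).
have c'0 k : 0 <= c' k by exact: powR_ge0.
have sk0 k : 0 <= s k by exact: s0.
pose W := map (idx N) (index_iota 0 L).
have uW : uniq W by rewrite map_inj_uniq ?iota_uniq//; exact: idx_inj.
have wn0 f r : (0 <= weighted_norm w f r q)%E.
  by rewrite /weighted_norm epowE ?poweR_ge0// invr_ge0.
pose y := \sum_(0 <= k < L) s k * c' k.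
pose z := \sum_(0 <= k < L) c' k.
have y0 : 0 <= y by apply: sumr_ge0 => k _; rewrite mulr_ge0.
have z0 : 0 <= z by apply: sumr_ge0.
apply: (@le_trans _ _ (K * C * y `^ p^-1)%:E); last first.
  rewrite EFinM lee_wpmul2l ?lee_fin//.
  rewrite sigma_normE// -poweR_EFin.
  apply: le_poweR; rewrite ?lee_fin// /y -sumEFin.
  have := @le_sum_esum _ _ [set: int] (fun n => (sigma_weight v p n * a n `^ p)%:E) W uW.
  rewrite big_map => /(_ (fun _ _ => I)); apply: le_trans.
  apply: lee_sum => k _; rewrite lee_fin ler_wpM2l//.
  by rewrite ge0_ler_powR ?nnegrE// trunc_le.
apply: (@eps_root _ p (K * C) y z) => //.
move=> e e_gt0.
have [||||||d [d0 dS dF]] := core L (fun i n => U (idx N i) (idx N n) `^ p)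
  (fun n => w (idx N n)) (fun k => s k + e) c'.
- by move=> i n; exact: powR_ge0.
- move=> i m n mn; rewrite ge0_ler_powR ?nnegrE// Umon//.
  exact: idx_le.
- move=> i j n ij jn.
  apply: (@le_trans _ _
      ((c * (U (idx N i) (idx N j) + U (idx N j) (idx N n))) `^ p)).
    rewrite ge0_ler_powR ?nnegrE ?mulr_ge0 ?addr_ge0 ?(ltW c0)//.
    by apply: Ureg; exact: idx_le.
  rewrite powRM ?addr_ge0 ?(ltW c0)// -mulrA ler_wpM2l ?powR_ge0//.
  exact: powR_add_le.
- by move=> n; exact: w0.
- by move=> n; rewrite ltr_wpDl.
- exact: c'0.
pose b (n : int) : R := if n < - N%:Z then 0 else
  if (absz (n + N%:Z)%R < L)%N then
    (c' (absz (n + N%:Z)) + d (absz (n + N%:Z))) `^ p^-1 else 0.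
have b0 : nonneg_seq b.
  by move=> n; rewrite /b; case: ifP => // _; case: ifP => // _; exact: powR_ge0.
have bE k : (k < L)%N -> b (idx N k) `^ p = c' k + d k.
  move=> kL; rewrite /b idx_ltN idxK kL.
  by rewrite -powRrM mulVf ?gt_eqF// powRr1// addr_ge0.
have bz n : (forall k : nat, (k < L)%N -> n <> idx N k) -> b n = 0.
  rewrite /b; case: ifPn => // nN; rewrite -leNgt in nN.
  have [k ->] := idx_surj nN; rewrite idxK => h; case: ifP => // kL.
  by have := h k kL.
have bpart i : (i < L)%N -> esum (upto (idx N i)) (fun j => epow (b j)%:E p) =
    (\sum_(0 <= j < i.+1) (c' j + d j))%:E.
  move=> iL; rewrite esum_upto_idx; last 2 first.
  - by move=> j; rewrite epowE// poweR_ge0.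
  - by move=> j jN; rewrite epowE// /b jN poweR0r// gt_eqF.
  rewrite -sumEFin big_nat [RHS]big_nat; apply: eq_bigr => j /andP[_ ji].
  by rewrite epowE// poweR_EFin bE// (leq_trans ji).
(* F is the supremum in (iii) for b, taken over the window *)
pose G i n := U (idx N i) (idx N n) `^ p * \sum_(0 <= j < i.+1) (c' j + d j).
pose F n := \big[Num.max/0]_(i < n.+1) G i n.
have S0 i : 0 <= \sum_(0 <= j < i.+1) (c' j + d j).
  by apply: sumr_ge0 => j _; rewrite addr_ge0.
have F0 n : 0 <= F n by exact: bigmax_ge_id.
have GF i n : (i <= n)%N -> G i n <= F n.
  move=> ni; have := @le_bigmax _ _ _ 0 (fun i : 'I_n.+1 => G i n) (inord i).
  by rewrite inordK.
have Fm m n : (m <= n)%N -> F m <= F n.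
  move=> mn; apply: bigmax_le => // i _.
  apply: le_trans (GF i n _); last by apply: leq_trans mn; rewrite -ltnS.
  by rewrite ler_wpM2r// ge0_ler_powR ?nnegrE// Umon// idx_le.
have {}dF := dF F F0 Fm.
set fiii := fun n => ereal_sup [set epow (U i n)%:E p *
  esum (upto i) (fun j => epow (b j)%:E p) | i in upto n]%E in H *.
have Ffiii n : (n < L)%N -> ((F n)%:E <= fiii (idx N n))%E.
  move=> nL; rewrite /F; elim/big_ind: _ => [|x1 x2 h1 h2|i _].
  - apply: le_ereal_sup_tmp; eexists; first by exists (idx N n) => //; rewrite /upto/=.
    by rewrite mule_ge0// ?epowE ?poweR_ge0// esum_ge0// => i _; rewrite epowE ?poweR_ge0.
  - by rewrite /Num.max; case: ifP.
  - apply: ereal_sup_ubound; exists (idx N i).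
      by rewrite /upto/=; apply: idx_le; rewrite -ltnS.
    rewrite bpart ?epowE ?poweR_EFin//.
    exact: leq_trans (ltn_ord i) nL.
have step : (weighted_norm w (g N) (q / p) q <=
    (M `^ q^-1)%:E * weighted_norm w fiii (q / p) q)%E.
  rewrite weighted_norm_le//; last by rewrite mule_ge0 ?lee_fin ?powR_ge0.
  rewrite poweRM ?lee_fin ?powR_ge0// poweR_EFin -powRrM mulVf ?gt_eqF//.
  rewrite powRr1 ?(ltW M0)// {1}/weighted_norm epowE ?invr_ge0// poweRVK//; last first.
    by apply: esum_ge0 => n _; rewrite mule_ge0 ?lee_fin// epowE ?poweR_ge0.
  rewrite (@esum_idx _ N L)//; last 2 first.
  - by move=> n; rewrite mule_ge0 ?lee_fin ?poweR_ge0.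
  - move=> n _ nW; rewrite /g ifF ?poweR0r ?mule0 ?gt_eqF//.
    apply/negbTE/negP => /abs_le_idx[k kL nk]; exact: (nW k).
  apply: (@le_trans _ _ (M * \sum_(0 <= n < L) w (idx N n) * F n `^ (q / p))%:E).
    apply: (@le_trans _ _ (\sum_(0 <= n < L) w (idx N n) *
        (\sum_(0 <= i < n.+1) U (idx N i) (idx N n) `^ p * c' i) `^ (q / p))%:E);
      last first.
      rewrite lee_fin; apply: dF => i n ni nL.
        apply: le_trans (GF i n ni); rewrite ler_wpM2l ?powR_ge0//.
        by apply: ler_sum => j _; rewrite lerDl.
      apply: le_trans (GF i n ni); rewrite ler_wpM2l ?powR_ge0//.
      rewrite big_nat_recr//= addrA lerDr addr_ge0 ?sumr_ge0// => j _.
      by rewrite addr_ge0.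
    rewrite -sumEFin le_eqVlt; apply/orP; left; apply/eqP.
    rewrite big_nat [RHS]big_nat; apply: eq_bigr => n /andP[_ nL].
    rewrite /g abs_idx_le//.
    rewrite esum_upto_idx; last 2 first.
    - by move=> j; rewrite lee_fin mulr_ge0 ?powR_ge0.
    - by move=> j jN; rewrite trunc_ltN// powR0 ?gt_eqF// mulr0.
    by rewrite sumEFin poweR_EFin EFinM.
  rewrite EFinM lee_wpmul2l ?lee_fin ?(ltW M0)// -sumEFin.
  have := @le_sum_esum _ _ [set: int] (fun n => (w n)%:E * epow (fiii n) (q / p))%E W uW.
  rewrite big_map => /(_ (fun _ _ => I)); apply: le_trans.
  rewrite [leLHS]big_nat [leRHS]big_nat; apply: lee_sum => n /andP[_ nL].
  rewrite EFinM lee_wpmul2l ?lee_fin// epowE// -poweR_EFin.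
  by apply: le_poweR; rewrite ?lee_fin ?Ffiii.
apply: le_trans step _.
have -> : K * C * (y + e * z) `^ p^-1 =
    M `^ q^-1 * (C * (2 * (y + e * z)) `^ p^-1).
  rewrite powRM// ?addr_ge0 ?mulr_ge0 ?(ltW e_gt0)// /K; ring.
rewrite EFinM lee_wpmul2l ?lee_fin ?powR_ge0//.
apply: le_trans (H b b0) _.
rewrite EFinM lee_wpmul2l ?lee_fin// sigma_normE// -poweR_EFin.
apply: le_poweR => //.
  by apply: esum_ge0 => n _; rewrite lee_fin mulr_ge0 ?powR_ge0.
rewrite (@esum_idx _ N L)//; last 2 first.
- by move=> n; rewrite lee_fin mulr_ge0 ?powR_ge0.
- by move=> n _ /bz ->; rewrite powR0 ?gt_eqF// mulr0.
rewrite sumEFin lee_fin.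
have yzE : y + e * z = \sum_(0 <= k < L) (s k + e) * c' k.
  by rewrite /y /z mulr_sumr -big_split/=; apply: eq_bigr => k _; rewrite mulrDl.
apply: (@le_trans _ _ (\sum_(0 <= k < L) (s k + e) * (c' k + d k))).
  rewrite big_nat [leRHS]big_nat; apply: ler_sum => k /andP[_ kL].
  by rewrite bE// ler_wpM2r ?addr_ge0// lerDl ltW.
under eq_bigr do rewrite mulrDr.
by rewrite big_split/= yzE; move: dS; lra.
Qed.

(** * Comparison of the best constants *)

Lemma best_constant_ge0 (R : realType) (I : R -> Prop) : (0 <= best_constant I)%E.
Proof. by apply: le_ereal_inf_tmp => _ [C [C0 _] <-]; rewrite lee_fin. Qed.

(** [L] only bounds the factor [K] of the implication, so that one constant can
    serve several comparisons. *)
Lemma best_constant_le (R : realType) (I J : R -> Prop) (K L : R) :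
  0 < K -> K <= L -> (forall C, 0 <= C -> I C -> J (K * C)) ->
  (best_constant J <= L%:E * best_constant I)%E.
Proof.
move=> K0 KL IJ; apply: (@le_trans _ _ (K%:E * best_constant I)%E); last first.
  by rewrite lee_wpmul2r ?best_constant_ge0.
rewrite -lee_pdivrMl//; apply: le_ereal_inf_tmp => _ [C [C0 IC] <-].
rewrite lee_pdivrMl// -EFinM; apply: ereal_inf_lbound.
by exists (K * C) => //; split; [rewrite mulr_ge0// ltW|exact: IJ].
Qed.

Theorem theorem3p10 (R : realType) (p q : R) (hp : 1 <= p) (hq : 0 < q) :
  (forall (v w : int -> R) (U : int -> int -> R),
     nonneg_seq v -> nonneg_seq w -> regular_kernel U ->
     ((exists2 C : R, 0 <= C & ineq_i p q v w U C) <->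
      (exists2 C' : R, 0 <= C' & ineq_ii p q v w U C')) /\
     ((exists2 C' : R, 0 <= C' & ineq_ii p q v w U C') <->
      (exists2 C'' : R, 0 <= C'' & ineq_iii p q v w U C''))) /\
  (forall c : R, 0 < c ->
   exists c1 c2 : R, [/\ 0 < c1, 0 < c2 &
     forall (v w : int -> R) (U : int -> int -> R),
       nonneg_seq v -> nonneg_seq w -> regular_with U c ->
       let C := best_constant (ineq_i p q v w U) in
       let C' := best_constant (ineq_ii p q v w U) in
       let C'' := best_constant (ineq_iii p q v w U) in
       [/\ (c1%:E * C' <= C)%E, (C <= c2%:E * C')%E,
           (c1%:E * C'' <= C')%E & (C' <= c2%:E * C'')%E]]).
Proof.
have [K1 K10 iii_i] := ineq_iii_i hp hq.
split=> [v w U v0 w0 [c c0 HU]|c c0].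
  have [K2 K20 iii_ii] := ineq_iii_ii hp hq c0.
  have [U0 Uanti _ _] := HU.
  split; split=> [] [C C0 HC].
  - exists (K2 * C); first by rewrite mulr_ge0// ltW.
    by apply: iii_ii => //; apply: ineq_i_iii.
  - exists (K1 * C); first by rewrite mulr_ge0// ltW.
    by apply: iii_i => //; apply: ineq_ii_iii.
  - by exists C => //; apply: ineq_ii_iii.
  - exists (K2 * C); first by rewrite mulr_ge0// ltW.
    exact: iii_ii.
have [K2 K20 iii_ii] := ineq_iii_ii hp hq c0.
have K2' : 0 < 1 + K2 by rewrite addr_gt0.
exists (1 + K2)^-1, (K1 + K2); split; [by rewrite invr_gt0|by rewrite addr_gt0|].
move=> v w U v0 w0 HU C C' C''; have [U0 Uanti _ _] := HU; split.
- rewrite lee_pdivrMl//; apply: (best_constant_le K20); first by rewrite lerDr.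
  by move=> D D0 HD; apply: iii_ii => //; apply: ineq_i_iii.
- apply: (best_constant_le K10); first by rewrite lerDl ltW.
  by move=> D D0 HD; apply: iii_i => //; apply: ineq_ii_iii.
- rewrite lee_pdivrMl//; apply: (best_constant_le ltr01).
    by rewrite lerDl ltW.
  by move=> D D0 HD; rewrite mul1r; apply: ineq_ii_iii.
- apply: (best_constant_le K20); first by rewrite lerDr ltW.
  by move=> D D0 HD; apply: iii_ii.
Qed.
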